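(* Let $\mathbb G$ be the set of equivalence classes of metric measure spaces and let $\operatorname{GW}$ be the Gromov--Wasserstein distance on $\mathbb G$. Then $(\mathbb G\times\mathbb G,\operatorname{GW}^2)$ is an NNCC space.
   Context: A metric measure space is a triple $(X,f,\mu)$ where $(X,f)$ is a complete separable metric space ($f$ is the distance) and $\mu$ is a Borel probability measure on $X$ with full support. Two metric measure spaces $(X,f,\mu)$ and $(Y,g,\nu)$ are equivalent if there is a map $T\colon X\to Y$ which is an isometry on the support of $\mu$ and satisfies $T_\#\mu=\nu$. The class of $(X,f,\mu)$ is denoted $[X,f,\mu]$. For $\mathbf X=[X,f,\mu]$ and $\mathbf Y=[Y,g,\nu]$, $$\operatorname{GW}^2(\mathbf X,\mathbf Y)=\inf_{\pi\in\Pi(\mu,\nu)}\int|f(x,x')-g(y,y')|^2\,d\pi(x,y)\,d\pi(x',y')\in[0,+\infty],$$ where $\Pi(\mu,\nu)$ is the set of couplings of $\mu$ and $\nu$. For arbitrary sets $A,B$ and a function $c\colon A\times B\to[-\infty,+\infty]$: given a path $\mathrm x\colon[0,1]\to A$ (an arbitrary function; no continuity is required) and $\bar y\in B$, the pair $(\mathrm x,\bar y)$ is a variational c-segment on $(A\times B,c)$ if $c(\mathrm x(s),\bar y)$ is finite for all $s\in[0,1]$ and, for all $s\in(0,1)$ and $y\in B$, $$c(\mathrm x(s),\bar y)-c(\mathrm x(s),y)\le (1-s)[c(\mathrm x(0),\bar y)-c(\mathrm x(0),y)]+s[c(\mathrm x(1),\bar y)-c(\mathrm x(1),y)],$$ with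 the usual arithmetic in $[-\infty,+\infty]$ and the rule $(+\infty)+(-\infty)=(-\infty)+(+\infty)=+\infty$ in the right-hand side. $(A\times B,c)$ is an NNCC space if for every $(x_0,x_1,\bar y)\in A\times A\times B$ such that $c(x_0,\bar y)$ and $c(x_1,\bar y)$ are finite, there exists a variational c-segment $(\mathrm x,\bar y)$ with $\mathrm x(0)=x_0$, $\mathrm x(1)=x_1$. *)

(* Defs.v *)
From HB Require Import structures.
From mathcomp Require Import all_boot all_order all_algebra.
From mathcomp Require Import all_classical all_reals all_analysis.
Set Implicit Arguments.
Unset Strict Implicit.
Unset Printing Implicit Defensive.
Import Order.TTheory GRing.Theory Num.Theory.
Import numFieldNormedType.Exports.
Local Open Scope classical_set_scope.
Local Open Scope ring_scope.

(* A path is a function on R of which only the values on [0, 1] matter.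
   In the dual scope %dE, (+oo) + (-oo) = (-oo) + (+oo) = +oo. The subtraction
   on the left-hand side is unambiguous, its first term being finite. *)
Definition variational_segment (R : realType) (A B : Type)
    (c : A -> B -> \bar R) (x : R -> A) (yb : B) : Prop :=
  (forall s : R, 0 <= s <= 1 -> c (x s) yb \is a fin_num) /\
  (forall (s : R) (y : B), 0 < s < 1 ->
    (c (x s) yb - c (x s) y <=
      (1 - s)%R%:E * (c (x 0%R) yb - c (x 0%R) y) +
      s%:E * (c (x 1%R) yb - c (x 1%R) y))%dE).

Definition NNCC_space (R : realType) (A B : Type)
    (c : A -> B -> \bar R) : Prop :=
  forall (x0 x1 : A) (yb : B),
    c x0 yb \is a fin_num -> c x1 yb \is a fin_num ->
    exists x : R -> A, [/\ variational_segment c x yb, x 0 = x0 & x 1 = x1].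

(* MathComp-Analysis asks complete spaces and measurable types to carry a
   distinguished point. The spaces below are nonempty anyway (they have total
   mass 1), and [mm_equiv] ignores the choice of that point. *)
#[short(type="completeMetricType")]
HB.structure Definition CompleteMetric (R : realType) :=
  {T of Metric R T & Complete T}.

Definition separable_space (T : topologicalType) : Prop :=
  exists D : set T, countable D /\ dense D.

Notation borel T := (g_sigma_algebraType (@open T)).

Definition measure_support (R : realType) (T : completeMetricType R)
    (mu : set (borel T) -> \bar R) : set T :=
  [set x | forall U : set T, open U -> U x -> (0 < mu U)%E].

Record mmspace (R : realType) := MMSpace {
  mm_car :> completeMetricType R;
  mm_separable : separable_space mm_car;
  mm_meas : probability (borel mm_car) R;
  mm_full_support : measure_support mm_meas = [set: mm_car] }.

Definition mm_equiv (R : realType) (X Y : mmspace R) : Prop :=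
  exists T : {mfun borel X >-> borel Y},
    (forall x x' : X,
      measure_support (mm_meas X) x -> measure_support (mm_meas X) x' ->
      @mdist R Y (T x) (T x') = mdist x x') /\
    (forall A : set (borel Y), measurable A ->
      pushforward (mm_meas X) T A = mm_meas Y A).

Definition couplings (R : realType) (X Y : mmspace R) :
    set (probability (borel X * borel Y)%type R) :=
  [set pi |
    (forall A : set (borel X), measurable A ->
      pushforward pi fst A = mm_meas X A) /\
    (forall B : set (borel Y), measurable B ->
      pushforward pi snd B = mm_meas Y B)].
Arguments couplings {R} X Y _.

Definition GW2_mm (R : realType) (X Y : mmspace R) : \bar R :=
  ereal_inf [set (\int[pi]_p \int[pi]_q
      (`| @mdist R X p.1 q.1 - @mdist R Y p.2 q.2 | ^+ 2)%:E)%E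
    | pi in couplings X Y].

Definition mm_class (R : realType) (X : mmspace R) : set (mmspace R) :=
  [set Y | mm_equiv X Y].

Definition GW_classes (R : realType) : Type :=
  {C : set (mmspace R) | exists X : mmspace R, C = mm_class X}.

Definition mm_repr (R : realType) (C : GW_classes R) : mmspace R :=
  projT1 (cid (proj2_sig C)).

(* [GW2_mm] is invariant under [mm_equiv], so the chosen representatives are
   immaterial. *)
Definition GW2 (R : realType) (C D : GW_classes R) : \bar R :=
  GW2_mm (mm_repr C) (mm_repr D).

(* Main.v *)
Require Import Defs.
From HB Require Import structures.
From mathcomp Require Import all_boot all_order all_algebra.
From mathcomp Require Import all_classical all_reals all_analysis.
From mathcomp Require Import finmap lra measurable_realfun.

(** The intermediate spaces come from optimal couplings. Let [pi0] and [pi1] be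
    optimal couplings of [X0] and [X1] with [Y]. Glued along [Y], they form the
    law of a random triple [(x0, x1, y)]. For [0 < s < 1] the point of the path
    at time [s] is the support [Z] of the law of [(x0, x1)], with the distance
    [(1 - s) * d0 + s * d1]; let [Gam] be the law of [((x0, x1), y)], a coupling
    of [Z] and [Y].

    For reals [a0], [a1], [b],
      [((1 - s) a0 + s a1 - b)^2 + s (1 - s) (a0 - a1)^2
         = (1 - s) (a0 - b)^2 + s (a1 - b)^2]    ([sqdist_mix]),
    where the correction does not involve [b]. Given another space [Y'] and a
    coupling [sig] of [Z] and [Y'], glue [sig] to [Gam] along [Z] and integrate
    this identity over pairs of points, with [a0], [a1] the distances in [X0]
    and [X1], and [b] the distance in [Y] or the one in [Y']. The corrections
    cancel, and
      [cost Gam + (1 - s) cost (x0, y') + s cost (x1, y')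
         = cost sig + (1 - s) cost pi0 + s cost pi1].
    Bounding the costs on the left by infima, using the optimality of [pi0] and
    [pi1], and taking the infimum over [sig] gives the inequality of a
    variational segment ([interpolation_key_inequality],
    [GW2_mm_interpolation]).

    Two facts of measure theory are used: couplings can be glued ([gluing]), and
    optimal couplings exist ([optimal_coupling]). Both rest on
    [bimeasure_extension]: a function of two sets that is additive in each of
    them, with measures as marginals, comes from a measure on the product as
    soon as one factor is a complete separable metric space. For gluing, the
    function is an integral of Radon-Nikodym densities. For optimal couplings,
    it is the limit along an ultrafilter of the masses that a minimizing
    sequence gives to rectangles; the cost is lower semicontinuous for this
    convergence because it is, up to Fatou's lemma, a supremum of step functions
    on rectangles ([GW_cost_le_step]). *)

Set Implicit Arguments.
Unset Strict Implicit.
Unset Printing Implicit Defensive.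
Import Order.TTheory GRing.Theory Num.Theory.
Import numFieldNormedType.Exports.
Local Open Scope classical_set_scope.
Local Open Scope ring_scope.

(** * Measurable rectangles and contents on them *)

(** Packs a measurable function whose proof of measurability is at hand, since
    [distribution], the image of a probability, takes a bundled function. *)
Definition mkmfun d d' (T : measurableType d) (U : measurableType d')
  (f : T -> U) (mf : measurable_fun setT f) : {mfun T >-> U} :=
  HB.pack f (isMeasurableFun.Build _ _ _ _ f mf).

(** A copy of the product type, so that the semiring of measurable rectangles
    does not compete with the product sigma-algebra already attached to it. *)
Definition rectangles (T1 T2 : Type) := (T1 * T2)%type.

Section rectangles.
Context d1 d2 (T1 : measurableType d1) (T2 : measurableType d2).
HB.instance Definition _ := Pointed.on (rectangles T1 T2).

Definition rectangle : set (set (rectangles T1 T2)) :=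
  [set R | exists A B, [/\ measurable A, measurable B & R = A `*` B]].

Lemma rectangle0 : rectangle set0.
Proof. by exists set0, set0; split=> //; rewrite set0X. Qed.

Lemma rectangleI : setI_closed rectangle.
Proof.
move=> _ _ [A [B [mA mB ->]]] [A' [B' [mA' mB' ->]]].
exists (A `&` A'), (B `&` B'); split; [exact: measurableI|exact: measurableI|].
by rewrite setXI.
Qed.

Lemma rectangleD : semi_setD_closed rectangle.
Proof.
move=> _ _ [A [B [mA mB ->]]] [A' [B' [mA' mB' ->]]].
exists [set (A `\` A') `*` B; (A `&` A') `*` (B `\` B')]; split.
- exact: finite_set2.
- move=> C [->|->].
    by exists (A `\` A'), B; split => //; exact: measurableD.
  by exists (A `&` A'), (B `\` B'); split => //;
    [exact: measurableI|exact: measurableD].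
- apply/seteqP; split=> [[x y] /= [[Ax By] nAB]|[x y]].
    have [A'x|nA'x] := pselect (A' x).
      exists ((A `&` A') `*` (B `\` B')); [by right|].
      by split=> //; split => //= B'y; apply: nAB.
    by exists ((A `\` A') `*` B); [by left|].
  by move=> [_ [->|->]] [] /=; rewrite /setX /=; tauto.
- move=> C D [->|->] [->|->] // [[x y]] [] /=.
    by move=> [[_ nA'x] _] [[]].
  by move=> [[_ A'x] _] [[]].
Qed.

HB.instance Definition _ :=
  @isSemiRingOfSets.Build default_measure_display (rectangles T1 T2)
    rectangle rectangle0 rectangleI rectangleD.
End rectangles.

Section bicontent.
Context d1 d2 (T1 : measurableType d1) (T2 : measurableType d2) (R : realType).
Variable b : set T1 -> set T2 -> R.
Hypothesis b_ge0 : forall A B, measurable A -> measurable B -> 0 <= b A B.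
Hypothesis bUl : forall A A' B, measurable A -> measurable A' -> measurable B ->
  A `&` A' = set0 -> b (A `|` A') B = b A B + b A' B.
Hypothesis bUr : forall A B B', measurable A -> measurable B -> measurable B' ->
  B `&` B' = set0 -> b A (B `|` B') = b A B + b A B'.

Lemma bicontent_splitl A E B : measurable A -> measurable E -> measurable B ->
  b A B = b (A `&` E) B + b (A `\` E) B.
Proof.
move=> mA mE mB; rewrite -bUl ?setUIDK//.
- exact: measurableI.
- exact: measurableD.
- by rewrite -subset0 => x [[_ Ex] [_]].
Qed.

Lemma bicontent_splitr A B E : measurable A -> measurable B -> measurable E ->
  b A B = b A (B `&` E) + b A (B `\` E).
Proof.
move=> mA mB mE; rewrite -bUr ?setUIDK//.
- exact: measurableI.
- exact: measurableD.
- by rewrite -subset0 => x [[_ Ex] [_]].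
Qed.

Lemma le_bicontentl A A' B : measurable A -> measurable A' -> measurable B ->
  A `<=` A' -> b A B <= b A' B.
Proof.
move=> mA mA' mB AA'; rewrite (bicontent_splitl mA' mA mB) setIidr//.
by rewrite lerDl b_ge0//; exact: measurableD.
Qed.

Lemma le_bicontentr A B B' : measurable A -> measurable B -> measurable B' ->
  B `<=` B' -> b A B <= b A B'.
Proof.
move=> mA mB mB' BB'; rewrite (bicontent_splitr mA mB' mB) setIidr//.
by rewrite lerDl b_ge0//; exact: measurableD.
Qed.

Lemma bicontent_subUl A A' B : measurable A -> measurable A' -> measurable B ->
  b (A `|` A') B <= b A B + b A' B.
Proof.
move=> mA mA' mB; rewrite (bicontent_splitl (measurableU _ _ mA mA') mA mB).
rewrite setUK lerD2l; apply: le_bicontentl => //.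
  by apply: measurableD => //; exact: measurableU.
by move=> x [[]].
Qed.

Lemma bicontent0l B : measurable B -> b set0 B = 0.
Proof.
move=> mB; have := bUl measurable0 measurable0 mB (set0I _).
by rewrite setU0 => /eqP; rewrite -subr_eq0 opprD addrA subrr sub0r oppr_eq0 => /eqP.
Qed.

Lemma bicontent0r A : measurable A -> b A set0 = 0.
Proof.
move=> mA; have := bUr mA measurable0 measurable0 (set0I _).
by rewrite setU0 => /eqP; rewrite -subr_eq0 opprD addrA subrr sub0r oppr_eq0 => /eqP.
Qed.

Variables (F : nat -> set T1) (G : nat -> set T2).
Hypotheses (mF : forall n, measurable (F n)) (mG : forall n, measurable (G n)).

(** Finitely many rectangles cover [A * B] up to [A' * T2]. Cutting [B] along the
    last [G n] moves [F n] into the exceptional set [A'] on one piece and drops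
    it on the other, so no common refinement of the rectangles is needed: when
    none is left, [A] is included in [A'] as soon as [B] is nonempty. *)
Lemma bicontent_cover n A' A B :
  measurable A' -> measurable A -> measurable B ->
  (forall x y, A x -> B y -> A' x \/ exists2 k, (k < n)%N & F k x /\ G k y) ->
  b A B <= b A' B + \sum_(k < n) b (F k) (G k `&` B).
Proof.
elim: n A' A B => [|n IH] A' A B mA' mA mB AB.
  rewrite big_ord0 addr0; have [->|/set0P[y By]] := eqVneq B set0.
    by rewrite !bicontent0r.
  by apply: le_bicontentl => // x Ax; have [//|[]] := AB _ _ Ax By.
have mBG := measurableI _ _ mB (mG n).
have mBD := measurableD mB (mG n).
have mAF := measurableU _ _ mA' (mF n).
rewrite (bicontent_splitr mA mB (mG n)).
have H1 := IH (A' `|` F n) A (B `&` G n) mAF mA mBG.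
have H2 := IH A' A (B `\` G n) mA' mA mBD.
have {}H1 : b A (B `&` G n) <=
    b A' (B `&` G n) + b (F n) (B `&` G n) +
    \sum_(k < n) b (F k) (G k `&` (B `&` G n)).
  apply: le_trans (H1 _) _; last by rewrite lerD2r bicontent_subUl.
  move=> x y Ax [By Gy]; have [|[k]] := AB _ _ Ax By; first by left; left.
  rewrite ltnS leq_eqVlt => /predU1P[->|kn] [Fx Gky]; first by left; right.
  by right; exists k.
have {}H2 : b A (B `\` G n) <= b A' (B `\` G n) +
    \sum_(k < n) b (F k) (G k `&` (B `\` G n)).
  apply: H2 => x y Ax [By Gy]; have [|[k]] := AB _ _ Ax By; first by left.
  rewrite ltnS leq_eqVlt => /predU1P[->|kn] [Fx Gky]; first by [].
  by right; exists k.
rewrite (bicontent_splitr mA' mB (mG n)) big_ord_recr /=.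
have -> : \sum_(k < n) b (F k) (G k `&` B) =
    \sum_(k < n) b (F k) (G k `&` (B `&` G n)) +
    \sum_(k < n) b (F k) (G k `&` (B `\` G n)).
  rewrite -big_split/=; apply: eq_bigr => k _.
  rewrite (@bicontent_splitr _ (G k `&` B) (G n))//; last exact: measurableI.
  by rewrite setIA setIDA.
rewrite [G n `&` B]setIC; lra.
Qed.

(** The reverse estimate for disjoint rectangles inside [A * B], by the same
    induction: on the part of [B] inside [G n] the others avoid [F n]. *)
Lemma bicontent_pack n A B : measurable A -> measurable B ->
  (forall k x y, (k < n)%N -> F k x -> G k y -> B y -> A x) ->
  (forall k l x y, (k < l < n)%N -> F k x -> G k y -> F l x -> G l y -> B y -> False) ->
  \sum_(k < n) b (F k) (G k `&` B) <= b A B.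
Proof.
elim: n A B => [|n IH] A B mA mB AB tF; first by rewrite big_ord0 b_ge0.
have mBG := measurableI _ _ mB (mG n).
have mBD := measurableD mB (mG n).
rewrite (bicontent_splitr mA mB (mG n)) big_ord_recr /=.
have -> : \sum_(k < n) b (F k) (G k `&` B) =
    \sum_(k < n) b (F k) (G k `&` (B `&` G n)) +
    \sum_(k < n) b (F k) (G k `&` (B `\` G n)).
  rewrite -big_split/=; apply: eq_bigr => k _.
  rewrite (@bicontent_splitr _ (G k `&` B) (G n))//; last exact: measurableI.
  by rewrite setIA setIDA.
have H1 : \sum_(k < n) b (F k) (G k `&` (B `&` G n)) <= b (A `\` F n) (B `&` G n).
  apply: IH => //; first exact: measurableD.
    move=> k x y kn Fx Gy [By Gny]; split; first by apply: AB Fx Gy By; apply: ltnW.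
    by move=> Fnx; apply: (tF k n x y) => //; rewrite kn ltnSn.
  move=> k l x y /andP[kl ln] Fkx Gky Flx Gly [By _].
  by apply: (tF k l x y) => //; rewrite kl ltnW.
have H2 : \sum_(k < n) b (F k) (G k `&` (B `\` G n)) <= b A (B `\` G n).
  apply: IH => //.
    by move=> k x y kn Fx Gy [By Gny]; apply: AB Fx Gy By; apply: ltnW.
  move=> k l x y /andP[kl ln] Fkx Gky Flx Gly [By _].
  by apply: (tF k l x y) => //; rewrite kl ltnW.
have H3 : b (F n) (B `&` G n) <= b (A `&` F n) (B `&` G n).
  have [->|/set0P[y [By Gy]]] := eqVneq (B `&` G n) set0.
    by rewrite !bicontent0r//; exact: measurableI.
  apply: le_bicontentl => //; first exact: measurableI.
  by move=> x Fx; split => //; apply: AB Fx Gy By.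
rewrite (bicontent_splitl mA (mF n) mBG) [G n `&` B]setIC; lra.
Qed.

End bicontent.

(** * Regularity of probabilities on complete separable metric spaces *)

Lemma geometric_partial_sum (R : realType) (e : R) N :
  \sum_(k < N) e / 2 ^+ k.+1 = e - e / 2 ^+ N.
Proof.
elim: N => [|N IH]; first by rewrite big_ord0 expr0 divr1 subrr.
rewrite big_ord_recr/= IH exprS invfM.
set t := _^-1; lra.
Qed.

Lemma exists_invS_lt (R : realType) (e : R) : 0 < e ->
  exists n, n.+1%:R^-1 < e.
Proof.
move=> e0; have [N _ /(_ N (leqnn N)) H] := near_infty_natSinv_lt (PosNum e0).
by exists N.
Qed.

Section metric_topology.
Context (R : realType) (X : completeMetricType R).

Lemma open_mdistP (U : set X) :
  open U <-> forall x, U x -> exists2 e : R, 0 < e & forall y, mdist x y < e -> U y.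
Proof.
rewrite openE; split=> [oU x /oU|oU x /oU].
  move=> /nbhs_ballP[e /= e0]; rewrite ballEmdist => eU.
  by exists e.
move=> [e e0 eU]; apply/nbhs_ballP; exists e => //.
by rewrite ballEmdist.
Qed.

Lemma closed_mdist_le (a : X) (r : R) : closed [set x | mdist a x <= r].
Proof.
rewrite -openC; apply/open_mdistP => x /= /negP; rewrite -ltNge => rx.
exists (mdist a x - r); first by rewrite subr_gt0.
move=> y xy; apply/negP; rewrite -ltNge.
have := metric_triangle a y x; rewrite (metric_sym y x); lra.
Qed.

Lemma open_mdist_lt (a : X) (r : R) : open [set x | mdist a x < r].
Proof.
apply/open_mdistP => x /= rx; exists (r - mdist a x); first by rewrite subr_gt0.
move=> y xy; have := metric_triangle a x y; lra.
Qed.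

Lemma separable_seq : separable_space X ->
  exists a : nat -> X, forall x (e : R), 0 < e -> exists n, mdist (a n) x < e.
Proof.
move=> [D [/countable_injP[f finj] dD]].
exists (fun n => xget point [set x | D x /\ f x = n]) => x e e0.
have [|z [/= xz Dz]] := dD [set z | mdist x z < e] _ (open_mdist_lt x e).
  by exists x; rewrite /= mdistxx.
exists (f z); set w := xget _ _.
have [Dw fwz] : D w /\ f w = f z by rewrite /w; case: xgetP => [y -> //|/(_ z)[]].
have -> : w = z by apply: finj => //; exact: mem_set.
by rewrite metric_sym.
Qed.

Lemma measurable_open (U : set X) : open U -> measurable (U : set (borel X)).
Proof. exact: sub_sigma_algebra. Qed.

Lemma measurable_closed (C : set X) : closed C -> measurable (C : set (borel X)).
Proof.
move=> cC; rewrite -(setCK C); apply: measurableC; apply: measurable_open.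
by rewrite openC.
Qed.
End metric_topology.

Section finite_measure_tools.
Context d (T : measurableType d) (R : realType) (mu : probability T R).

Lemma measure_mono (A B : set T) : measurable A -> measurable B -> A `<=` B ->
  (mu A <= mu B)%E.
Proof. by move=> mA mB; apply: le_measure; exact: mem_set. Qed.

Lemma measure_bigcup_geometric (D : nat -> set T) (e : R) : 0 <= e ->
  (forall k, measurable (D k)) ->
  (forall k, (mu (D k) <= (e / 2 ^+ k.+1)%:E)%E) ->
  (mu (\bigcup_k D k) <= e%:E)%E.
Proof.
move=> e0 mD De.
have mUD : measurable (\bigcup_k D k) by exact: bigcup_measurable.
apply: (@le_trans _ _ (\sum_(k <oo) mu (D k))%E).
  exact: measure_sigma_subadditive.
apply: lime_le; first exact: is_cvg_nneseries.
apply: nearW => n; rewrite big_mkord.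
apply: (@le_trans _ _ (\sum_(k < n) (e / 2 ^+ k.+1)%:E)%E); first exact: lee_sum.
rewrite sumEFin lee_fin geometric_partial_sum gerBl.
by rewrite divr_ge0// exprn_ge0.
Qed.

Lemma measure_vanishing (D : nat -> set T) (e : R) : 0 < e ->
  (forall k, measurable (D k)) -> nonincreasing_seq D -> \bigcap_k D k = set0 ->
  exists n, (mu (D n) <= e%:E)%E.
Proof.
move=> e0 mD nD D0.
have mID : measurable (\bigcap_k D k) by rewrite D0.
have fD k : mu (D k) \is a fin_num by exact: fin_num_measure.
have D0oo : (mu (D 0%N) < +oo)%E by rewrite ltey_eq fD.
have := nonincreasing_cvg_mu D0oo mD mID nD; rewrite D0 measure0.
move=> /fine_cvgP[_] /cvgrPdist_le /(_ _ e0)[N _ /(_ N (leqnn N))] /=.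
rewrite sub0r normrN => H; exists N; rewrite -[mu _]fineK// lee_fin.
exact: le_trans (ler_norm _) H.
Qed.

End finite_measure_tools.

Section rectangle_additivity.
Context d1 d2 (T1 : measurableType d1) (T2 : measurableType d2) (R : realType).
Variable (mu : probability (T1 * T2)%type R).

Lemma measure_rectangleUl (A A' : set T1) (B : set T2) :
  measurable A -> measurable A' -> measurable B -> A `&` A' = set0 ->
  (mu ((A `|` A') `*` B) = mu (A `*` B) + mu (A' `*` B))%E.
Proof.
move=> mA mA' mB AA'.
rewrite (_ : (A `|` A') `*` B = A `*` B `|` A' `*` B); last first.
  apply/seteqP; split => [[x y] [[?|?] ?]|[x y] [[? ?]|[? ?]]];
    by [left|right|split => //; left|split => //; right].
rewrite measureU//; [exact: measurableX|exact: measurableX|].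
rewrite -subset0 => -[x y] [[/= Ax _] [/= A'x _]].
by have : (A `&` A') x by []; rewrite AA'.
Qed.

Lemma measure_rectangleUr (A : set T1) (B B' : set T2) :
  measurable A -> measurable B -> measurable B' -> B `&` B' = set0 ->
  (mu (A `*` (B `|` B')) = mu (A `*` B) + mu (A `*` B'))%E.
Proof.
move=> mA mB mB' BB'.
rewrite (_ : A `*` (B `|` B') = A `*` B `|` A `*` B'); last first.
  apply/seteqP; split => [[x y] [? [?|?]]|[x y] [[? ?]|[? ?]]];
    by [left|right|split => //; left|split => //; right].
rewrite measureU//; [exact: measurableX|exact: measurableX|].
rewrite -subset0 => -[x y] [[/= _ By] [/= _ B'y]].
by have : (B `&` B') y by []; rewrite BB'.
Qed.
End rectangle_additivity.

Section regularity.
Context (R : realType) (X : completeMetricType R) (mu : probability (borel X) R).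

(** The sets that are almost closed and almost open for [mu] form a
    sigma-algebra; this is why both approximations are asked at once. *)
Definition closed_open_regular (A : set X) := forall e : R, 0 < e ->
  exists C U : set X, [/\ closed C, open U, C `<=` A, A `<=` U &
    (mu (U `\` C) <= e%:E)%E].

(** An open set is the increasing union of the closed sets of its points at
    distance at least [1 / n.+1] from the complement. *)
Lemma closed_open_regular_open (U : set X) : open U -> closed_open_regular U.
Proof.
move=> oU e e0.
pose C n := [set x | forall y, mdist x y < n.+1%:R^-1 :> R -> U y].
have cC n : closed (C n).
  rewrite -openC; apply/open_mdistP => x /= /existsNP[y /not_implyP[xy nUy]].
  exists (n.+1%:R^-1 - mdist x y); first by rewrite subr_gt0.
  move=> z xz; apply/existsNP; exists y; apply/not_implyP; split => //.
  apply: (le_lt_trans (metric_triangle z x y)); rewrite (metric_sym z x).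
  by rewrite -ltrBrDr.
have CU n : C n `<=` U.
  by move=> x; apply; rewrite mdistxx invr_gt0.
have [n Hn] : exists n, (mu (U `\` C n) <= e%:E)%E.
  apply: measure_vanishing => //.
  - move=> k; apply: measurableD; first exact: measurable_open.
    exact: measurable_closed.
  - move=> m n mn; apply/subsetPset => x [Ux Cn]; split => // Cm; apply: Cn => y xy.
    apply: Cm; apply: (lt_le_trans xy).
    by rewrite lef_pV2 ?posrE// ler_nat.
  - rewrite -subset0 => x nC.
    have [Ux _] := nC 0%N Logic.I; have /open_mdistP/(_ x Ux)[r r0 rU] := oU.
    have [n nr] := exists_invS_lt r0.
    have [_] := nC n Logic.I; apply => y xy; apply: rU; exact: lt_trans nr.
by exists (C n), U; split.
Qed.

Lemma closed_open_regularC A : closed_open_regular A -> closed_open_regular (~` A).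
Proof.
move=> rA e /rA[C [U [cC oU CA AU mUC]]].
exists (~` U), (~` C); split; [by rewrite closedC|by rewrite openC| | |].
- exact: subsetC.
- exact: subsetC.
- by rewrite setDE setCK setIC -setDE.
Qed.

Lemma closed_open_regular_bigcup (A : nat -> set X) :
  (forall k, closed_open_regular (A k)) -> closed_open_regular (\bigcup_k A k).
Proof.
move=> rA e e0; have e2 : 0 < e / 2 by rewrite divr_gt0.
have /choice[C /choice[U HCU]] : forall k, exists C U : set X,
    [/\ closed C, open U, C `<=` A k, A k `<=` U &
    (mu (U `\` C) <= (e / 2 / 2 ^+ k.+1)%:E)%E].
  by move=> k; apply: rA; rewrite divr_gt0// exprn_gt0.
have mC k : measurable (C k : set (borel X)).
  by apply: measurable_closed; case: (HCU k).
have mU k : measurable (U k : set (borel X)).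
  by apply: measurable_open; case: (HCU k).
have mUC : measurable (\bigcup_k C k : set (borel X)) by exact: bigcup_measurable.
have mUU : measurable (\bigcup_k U k : set (borel X)) by exact: bigcup_measurable.
pose CN n : set X := \big[setU/set0]_(k < n) C k.
have mCN n : measurable (CN n : set (borel X)) by exact: bigsetU_measurable.
have [n Hn] : exists n, (mu (\bigcup_k C k `\` CN n) <= (e / 2)%:E)%E.
  apply: measure_vanishing => //.
  - by move=> k; exact: measurableD.
  - move=> m n mn; apply/subsetPset => x [Ux Cn]; split => // Cm; apply: Cn.
    by apply: subset_bigsetU Cm.
  - rewrite -subset0 => x nC; have [[k _ Ckx] _] := nC 0%N Logic.I.
    have [_] := nC k.+1 Logic.I; apply.
    by rewrite /CN -bigcup_mkord; exists k => /=.
exists (CN n), (\bigcup_k U k); split.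
- rewrite /CN -bigcup_mkord; apply: closed_bigcup => //.
  by move=> k _; case: (HCU k).
- by apply: bigcup_open => k _; case: (HCU k).
- rewrite /CN -bigcup_mkord => x [k _ Ckx]; exists k => //.
  by case: (HCU k) => _ _ + _ _; apply.
- move=> x [k _ Akx]; exists k => //.
  by case: (HCU k) => _ _ _ + _; apply.
apply: (@le_trans _ _ (mu (\bigcup_k (U k `\` C k) `|` (\bigcup_k C k `\` CN n)))).
  apply: measure_mono.
  - exact: measurableD.
  - apply: measurableU; last exact: measurableD.
    by apply: bigcup_measurable => k _; exact: measurableD.
  - move=> x [[k _ Ukx] nC]; have [Cx|nCx] := pselect ((\bigcup_k C k) x).
      by right.
    by left; exists k => //; split => // Ckx; apply: nCx; exists k.
apply: (le_trans (measureU2 _ _ _)); [|exact: measurableD|].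
  by apply: bigcup_measurable => k _; exact: measurableD.
rewrite [e]splitr EFinD; apply: leeD => //.
apply: measure_bigcup_geometric; first exact: ltW.
  by move=> k; exact: measurableD.
by move=> k; case: (HCU k).
Qed.

Lemma measurable_closed_open_regular (A : set (borel X)) :
  measurable A -> closed_open_regular A.
Proof.
move: A; apply: smallest_sub; last exact: closed_open_regular_open.
split.
- by apply: closed_open_regular_open; exact: open0.
- by move=> A rA; rewrite setTD; exact: closed_open_regularC.
- by move=> A rA; exact: closed_open_regular_bigcup.
Qed.

Lemma ultra_finite_cover (F : set_system X) (n : nat) (B : nat -> set X) :
  UltraFilter F -> F (\bigcup_(k < n) B k) -> exists k, F (B k).
Proof.
move=> UF FB; apply: contrapT => /forallNP nB.
have H m : F (\bigcap_(k < m) ~` B k).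
  elim: m => [|m IH]; first by apply: filterS filterT => x _ k.
  have FBm : F (~` B m) by have [/nB|] := in_ultra_setVsetC (B m) UF.
  apply: filterS (filterI IH FBm) => x [Hx Bm] k /=.
  by rewrite ltnS leq_eqVlt => /predU1P[->//|]; exact: Hx.
by have [x [[k kn Bx] /(_ k kn)]] := filter_ex (filterI FB (H n)).
Qed.

(** Ulam's theorem. For each [m] finitely many closed balls of radius
    [1 / m.+1] carry all the mass but [e / 2 ^ m.+1]; the intersection over [m]
    is closed and totally bounded. An ultrafilter on it contains one of the
    balls of each radius, so it is Cauchy and converges by completeness. *)
Lemma tight_probability : separable_space X -> forall e : R, 0 < e ->
  exists K : set X, [/\ compact K, closed K & (mu (~` K) <= e%:E)%E].
Proof.
move=> /separable_seq[a ha] e e0.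
pose B m i : set X := [set x | mdist (a i) x <= m.+1%:R^-1 :> R].
have cB m n : closed (\bigcup_(i < n) B m i).
  by apply: closed_bigcup => // i _; exact: closed_mdist_le.
have mB m n : measurable (\bigcup_(i < n) B m i : set (borel X)).
  exact: measurable_closed.
have /choice[N HN] : forall m, exists n,
    (mu (~` \bigcup_(i < n) B m i) <= (e / 2 ^+ m.+1)%:E)%E.
  move=> m; apply: measure_vanishing.
  - by rewrite divr_gt0// exprn_gt0.
  - by move=> n; exact: measurableC.
  - move=> k l kl; apply/subsetPset; apply: subsetC => x [i /= ik Bx].
    by exists i => //=; exact: leq_trans kl.
  - rewrite -subset0 => x nB; have m0 : 0 < m.+1%:R^-1 :> R by rewrite invr_gt0.
    have [i ix] := ha x _ m0.
    by apply: (nB i.+1 Logic.I); exists i => //=; exact: ltW.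
exists (\bigcap_m \bigcup_(i < N m) B m i).
have cK : closed (\bigcap_m \bigcup_(i < N m) B m i) by exact: closed_bigI.
split => //; last first.
  rewrite setC_bigcap; apply: measure_bigcup_geometric => //.
    exact: ltW.
  by move=> k; exact: measurableC.
rewrite compact_ultra => F UF FK.
have cF : cauchy F.
  apply: cauchy_exP => r r0.
  have [m mr] := exists_invS_lt r0.
  have [i FB] : exists i, F (B m i).
    apply: (ultra_finite_cover (n := N m)).
    by apply: filterS FK => x /(_ m Logic.I).
  exists (a i); apply: filterS FB => x; rewrite /B ballEmdist /= => H.
  exact: le_lt_trans mr.
have /cvg_ex[p Fp] : cvg F by exact: cauchy_cvg.
exists p; split => //; apply: cK => W Wp.
exact: filter_ex (filterI FK (Fp _ Wp)).
Qed.

Lemma probability_inner_compact : separable_space X ->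
  forall (A : set (borel X)) (e : R), measurable A -> 0 < e ->
  exists K : set (borel X), [/\ measurable K, @compact X K, K `<=` A &
    (mu (A `\` K) <= e%:E)%E].
Proof.
move=> sX A e mA e0; have e2 : 0 < e / 2 by rewrite divr_gt0.
have [C [U [cC oU CA AU mUC]]] := measurable_closed_open_regular mA e2.
have [K [kK cK muK]] := tight_probability sX e2.
have mC := measurable_closed cC; have mK := measurable_closed cK.
have mU := measurable_open oU.
exists (C `&` K); split.
- exact: measurableI.
- by apply: (subclosed_compact _ kK); [exact: closedI|exact: subIsetr].
- by move=> x [/CA].
apply: (@le_trans _ _ (mu ((U `\` C) `|` ~` K))).
  apply: measure_mono.
  - by apply: measurableD => //; exact: measurableI.
  - by apply: measurableU; [exact: measurableD|exact: measurableC].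
  - move=> x [Ax nCK]; have [Cx|nCx] := pselect (C x).
      by right=> Kx; apply: nCK.
    by left; split => //; exact: AU.
apply: (le_trans (measureU2 _ _ _)); [exact: measurableD|exact: measurableC|].
by rewrite [e]splitr EFinD; exact: leeD.
Qed.

Lemma probability_outer_open (A : set (borel X)) (e : R) : measurable A -> 0 < e ->
  exists U : set (borel X), [/\ measurable U, @open X U, A `<=` U &
    (mu (U `\` A) <= e%:E)%E].
Proof.
move=> mA e0; have [C [U [cC oU CA AU mUC]]] := measurable_closed_open_regular mA e0.
have mU := measurable_open oU; have mC := measurable_closed cC.
exists U; split => //; apply: le_trans mUC.
apply: measure_mono; [exact: measurableD|exact: measurableD|].
by move=> x [Ux nA]; split => // /CA.
Qed.

End regularity.

(** * Extension of bimeasures *)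

Lemma image_setX (T1 T2 : Type) (A : set T1) (B : set T2) : A !=set0 -> B !=set0 ->
  fst @` (A `*` B) = A /\ snd @` (A `*` B) = B.
Proof.
move=> [x Ax] [y By]; split; apply/seteqP; split.
- by move=> _ [[? ?] [? ?] <-].
- by move=> a Aa; exists (a, y).
- by move=> _ [[? ?] [? ?] <-].
- by move=> c Bc; exists (x, c).
Qed.

Section bimeasure.
Context (R : realType) (X : completeMetricType R) d (Y : measurableType d).
Variables (mu : probability (borel X) R) (nu : probability Y R).
Hypothesis sX : separable_space X.
Variable b : set (borel X) -> set Y -> R.
Hypothesis b_ge0 : forall A B, measurable A -> measurable B -> 0 <= b A B.
Hypothesis bUl : forall A A' B, measurable A -> measurable A' -> measurable B ->
  A `&` A' = set0 -> b (A `|` A') B = b A B + b A' B.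
Hypothesis bUr : forall A B B', measurable A -> measurable B -> measurable B' ->
  B `&` B' = set0 -> b A (B `|` B') = b A B + b A B'.
Hypothesis bmu : forall A, measurable A -> (b A setT)%:E = mu A.
Hypothesis bnu : forall B, measurable B -> (b setT B)%:E = nu B.

Let mu_inner := probability_inner_compact mu sX.
Let mu_outer := @probability_outer_open R X mu.

(** Countable covers reduce to finite ones by compactness in the first factor
    alone. Shrink [A] to a compact [K] and enlarge each [F k] to an open [U k].
    For each [y] in [B], the [U k] with [y] in [G k] cover [K], hence finitely
    many of them do; so [B] is the increasing union of the sets [BN N] of points
    [y] for which those of index below [N] suffice, and [BN N] carries almost
    all the mass of [B]. *)
Lemma bimeasure_sigma_cover (F : nat -> set (borel X)) (G : nat -> set Y)
    (A : set (borel X)) (B : set Y) (e : R) :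
  (forall k, measurable (F k)) -> (forall k, measurable (G k)) ->
  measurable A -> measurable B -> 0 < e ->
  A `*` B `<=` \bigcup_k (F k `*` G k) ->
  exists N, b A B <= \sum_(k < N) b (F k) (G k) + e.
Proof.
move=> mF mG mA mB e0 AB.
have e3 : 0 < e / 3 by rewrite divr_gt0.
have [K [mK cK KA muK]] := mu_inner mA e3.
have /choice[U HU] : forall k, exists U : set (borel X),
    [/\ measurable U, @open X U, F k `<=` U &
    (mu (U `\` F k) <= (e / 3 / 2 ^+ k.+1)%:E)%E].
  by move=> k; apply: mu_outer => //; rewrite divr_gt0// exprn_gt0.
have mU k : measurable (U k) by case: (HU k).
(* A union over finitely many index sets I, which makes BN N measurable. *)
pose BN N := B `&` \bigcup_(I in [set I : {set 'I_N} |
    K `<=` \bigcup_(k in [set k | k \in I]) U k]) \bigcap_(k in [set k | k \in I]) G k.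
have mBN N : measurable (BN N).
  apply: measurableI => //; apply: fin_bigcup_measurable => // I _.
  by apply: fin_bigcap_measurable => //; exact: finite_finset.
have BNB N : BN N `<=` B by move=> y [].
have BNcov N x y : K x -> BN N y -> exists2 k, (k < N)%N & U k x /\ G k y.
  move=> Kx [By [I /= KI GI]]; have [k kI Ux] := KI _ Kx.
  by exists k => //; split => //; exact: GI.
have BNU : \bigcup_N BN N = B.
  apply/seteqP; split=> [y [N _]|y By]; first exact: BNB.
  move: (cK); rewrite compact_cover => /(_ nat [set k | G k y] U) [|x Kx|D DG KD].
  - by move=> k _; case: (HU k).
  - have [k _ [Fx Gy]] := AB (x, y) (conj (KA _ Kx) By).
    by exists k => //; case: (HU k) => _ _ FU _; exact: FU.
  exists (\max_(k <- finmap.enum_fset D) k).+1 => //; split => //.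
  set N := (\max_(k <- _) _).+1.
  exists (finset (fun k : 'I_N => val k \in D)).
    move=> x /KD[k kD Ux].
    have kN : (k < N)%N by rewrite ltnS; apply: leq_bigmax_seq.
    by exists (Ordinal kN) => //=; rewrite inE.
  by move=> k /=; rewrite inE => /DG /set_mem.
have ndBN : nondecreasing_seq BN.
  move=> n m nm; apply/subsetPset => y [By [I /= KI GI]]; split => //.
  exists (imset (widen_ord nm) (mem I)) => /=.
    move=> x /KI[k kI Ukx]; exists (widen_ord nm k) => //=.
    by apply/imsetP; exists k.
  by move=> _ /= /imsetP[k kI ->]; exact: GI.
have [N nuN] : exists N, b setT (B `\` BN N) <= e / 3.
  have mBU : measurable (\bigcup_n BN n) by rewrite BNU.
  have : EFin \o (fun N => b setT (BN N)) @ \oo --> (b setT B)%:E.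
    have -> : EFin \o (fun N => b setT (BN N)) = nu \o BN.
      by apply/funext => N /=; exact: bnu.
    by rewrite bnu// -[in nu B]BNU; exact: nondecreasing_cvg_mu.
  move=> /fine_cvgP[_] /cvgrPdist_le /(_ _ e3)[N _ /(_ N (leqnn N))].
  rewrite /= => Hn; exists N; move: Hn.
  rewrite {1}(bicontent_splitr bUr measurableT mB (mBN N)) (setIidr (BNB N)).
  by rewrite [X in X - _]addrC addrK => /(le_trans (ler_norm _)).
exists N.
have H1 : b A B <= b K B + e / 3.
  rewrite (bicontent_splitl bUl mA mK mB) (setIidr KA) lerD2l.
  rewrite -lee_fin; apply: le_trans muK; rewrite -bmu; last exact: measurableD.
  rewrite lee_fin; apply: (le_bicontentr b_ge0 bUr) => //; exact: measurableD.
have H2 : b K B <= b K (BN N) + e / 3.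
  rewrite (bicontent_splitr bUr mK mB (mBN N)) (setIidr (BNB N)) lerD2l.
  apply: le_trans nuN; apply: (le_bicontentl b_ge0 bUl) => //; exact: measurableD.
have H3 : b K (BN N) <= \sum_(k < N) b (U k) (G k).
  have /= := bicontent_cover b_ge0 bUl bUr mU mG measurable0 mK (mBN N).
  move=> /(_ N) H; apply: (le_trans (H _)); last first.
    rewrite (bicontent0l bUl)// add0r; apply: ler_sum => k _.
    by apply: (le_bicontentr b_ge0 bUr) => //; exact: measurableI.
  by move=> x y Kx /(BNcov _ _ _ Kx) ?; right.
have H4 : \sum_(k < N) b (U k) (G k) <=
    \sum_(k < N) b (F k) (G k) + \sum_(k < N) e / 3 / 2 ^+ k.+1.
  rewrite -big_split/=; apply: ler_sum => k _.
  have [_ _ FU muU] := HU k.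
  rewrite (bicontent_splitl bUl (mU k) (mF k) (mG k)) (setIidr FU) lerD2l.
  rewrite -lee_fin; apply: le_trans muU; rewrite -bmu; last exact: measurableD.
  rewrite lee_fin; apply: (le_bicontentr b_ge0 bUr) => //; exact: measurableD.
have := geometric_partial_sum (e / 3) N.
have : 0 <= e / 3 / 2 ^+ N by rewrite divr_ge0 ?exprn_ge0// ltW.
lra.
Qed.

(** The sides of a rectangle are recovered as its projections, which are both
    empty when the rectangle is. *)
Lemma rectangleE (S : set (rectangles (borel X) Y)) : measurable S ->
  [/\ measurable (fst @` S), measurable (snd @` S) & S = (fst @` S) `*` (snd @` S)].
Proof.
move=> [A [B [mA mB ->]]].
have [->|/set0P A0] := eqVneq A set0; first by rewrite set0X !image_set0 set0X.
have [->|/set0P B0] := eqVneq B set0; first by rewrite setX0 !image_set0 set0X.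
by have [-> ->] := image_setX A0 B0.
Qed.

(** Set to 0 off the semiring, since a content is nonnegative at every set. *)
Let rect_mu (S : set (rectangles (borel X) Y)) : \bar R :=
  if `[< measurable S >] then (b (fst @` S) (snd @` S))%:E else 0%E.

Let rect_mu0 : rect_mu set0 = 0%E.
Proof.
by rewrite /rect_mu; case: ifP => // _; rewrite !image_set0 (bicontent0l bUl).
Qed.

Let rect_mu_ge0 S : (0 <= rect_mu S)%E.
Proof.
rewrite /rect_mu; case: ifP => // /asboolP /rectangleE[m1 m2 _].
by rewrite lee_fin b_ge0.
Qed.

Let rect_muE S : measurable S -> rect_mu S = (b (fst @` S) (snd @` S))%:E.
Proof. by move=> mS; rewrite /rect_mu; case: asboolP. Qed.

Let rect_mu_semi_sigma_additive : semi_sigma_additive rect_mu.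
Proof.
move=> S mS tS mUS.
pose F k := fst @` S k; pose G k := snd @` S k.
have mF k : measurable (F k) by have [] := rectangleE (mS k).
have mG k : measurable (G k) by have [] := rectangleE (mS k).
have SE k : S k = F k `*` G k by have [] := rectangleE (mS k).
have [mA mB UE] := rectangleE mUS.
set A := fst @` _ in mA UE; set B := snd @` _ in mB UE.
pose s n := \sum_(k < n) b (F k) (G k).
have -> : (fun n => \sum_(0 <= i < n) rect_mu (S i))%E = EFin \o s.
  apply/funext => n /=; rewrite /s big_mkord -sumEFin.
  by apply: eq_bigr => k _; rewrite rect_muE.
rewrite rect_muE// -/A -/B.
apply/cvg_EFin; first exact: nearW.
have GB k : G k `<=` B by move=> _ [p Sp <-]; exists p => //; exists k.
have FA k : F k `<=` A by move=> _ [p Sp <-]; exists p => //; exists k.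
have sle n : s n <= b A B.
  have /= := bicontent_pack b_ge0 bUl bUr mF mG (n := n) mA mB.
  rewrite (eq_bigr (fun k : 'I_n => b (F k) (G k))) => [|k _]; last first.
    by rewrite (setIidl (GB _)).
  apply=> [k x y _ /FA//|k l x y /andP[kl _] Fk Gk Fl Gl _].
  have /trivIsetP /(_ k l Logic.I Logic.I) := tS.
  have kl' : k != l by rewrite neq_ltn kl.
  move=> /(_ kl'); rewrite !SE => /seteqP[/(_ (x, y)) + _]; apply.
  by split.
apply/cvgrPdist_le => e e0.
have [|N HN] := bimeasure_sigma_cover (F := F) (G := G) mF mG mA mB e0.
  by rewrite -UE => p [k _ Sp]; exists k => //; rewrite -SE.
exists N => // n /= Nn; rewrite ger0_norm ?subr_ge0 ?sle//.
have : s N <= s n.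
  rewrite /s -(subnKC Nn) big_split_ord/= lerDl sumr_ge0// => i _.
  exact: b_ge0.
rewrite /s in HN *; lra.
Qed.

HB.instance Definition _ := isMeasure.Build _ _ _ rect_mu
  rect_mu0 rect_mu_ge0 rect_mu_semi_sigma_additive.

Let pi_fun (S : set (borel X * Y)) : \bar R := measure_extension rect_mu S.

Let measurable_rect (S : set (borel X * Y)) : measurable S ->
  measurable (S : set (g_sigma_algebraType (@measurable _ (rectangles (borel X) Y)))).
Proof.
rewrite measurable_prod_measurableType => mS.
move: S mS; apply: smallest_sub; first exact: smallest_sigma_algebra.
move=> _ [A mA [B mB <-]]; apply: sub_sigma_algebra.
by exists A, B.
Qed.

Let pi_fun0 : pi_fun set0 = 0%E. Proof. exact: measure0. Qed.

Let pi_fun_ge0 S : (0 <= pi_fun S)%E. Proof. exact: measure_ge0. Qed.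

Let pi_fun_semi_sigma_additive : semi_sigma_additive pi_fun.
Proof.
move=> S mS tS mUS.
exact: (measure_semi_sigma_additive (s := measure_extension rect_mu) S
  (fun k => measurable_rect (mS k)) tS (measurable_rect mUS)).
Qed.

HB.instance Definition _ := isMeasure.Build _ _ _ pi_fun
  pi_fun0 pi_fun_ge0 pi_fun_semi_sigma_additive.

Let pi_funE A B : measurable A -> measurable B -> pi_fun (A `*` B) = (b A B)%:E.
Proof.
move=> mA mB; have mAB : @measurable _ (rectangles (borel X) Y) (A `*` B).
  by exists A, B.
rewrite /pi_fun /measure_extension /= measurable_mu_extE//= rect_muE//.
have [->|/set0P A0] := eqVneq A set0.
  by rewrite set0X !image_set0 !(bicontent0l bUl).
have [->|/set0P B0] := eqVneq B set0.
  by rewrite setX0 !image_set0 !(bicontent0r bUr).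
by have [-> ->] := image_setX A0 B0.
Qed.

Let pi_funT : pi_fun setT = 1%E.
Proof. by rewrite -setXTT pi_funE// bmu// probability_setT. Qed.

HB.instance Definition _ := Measure_isProbability.Build _ _ _ pi_fun pi_funT.

(** The theorem of Marczewski and Ryll-Nardzewski: a bimeasure whose marginals
    are measures, one of them tight, extends to a measure on the product. Both
    uses below produce a function of two sets that is only visibly additive in
    each variable, and this lemma makes a measure of it. *)
Lemma bimeasure_extension :
  exists pi : probability (borel X * Y)%type R,
    forall A B, measurable A -> measurable B -> pi (A `*` B) = (b A B)%:E.
Proof. by exists pi_fun; exact: pi_funE. Qed.

End bimeasure.

(** * Gluing of couplings *)

Section slice.
Context d1 d2 (Y : measurableType d1) (Z : measurableType d2) (R : realType).
Variables (sigma : probability (Y * Z)%type R) (B : set Y).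

Definition slice_measure (mB : measurable B) : set Z -> \bar R :=
  fun D => sigma (B `*` D).

Variable mB : measurable B.

Let slice0 : slice_measure mB set0 = 0%E.
Proof. by rewrite /slice_measure setX0 measure0. Qed.

Let slice_ge0 D : (0 <= slice_measure mB D)%E.
Proof. exact: measure_ge0. Qed.

Let slice_semi_sigma_additive : semi_sigma_additive (slice_measure mB).
Proof.
move=> F mF tF mUF; rewrite /slice_measure setX_bigcupr.
apply: measure_semi_sigma_additive => //.
- by move=> k; exact: measurableX.
- apply/trivIsetP => i j _ _ ij; have /trivIsetP/(_ i j Logic.I Logic.I ij) FF := tF.
  rewrite -subset0 => -[y z] [[/= _ Fi] [/= _ Fj]].
  by move: FF => /seteqP[/(_ z) + _]; apply; split.
- by rewrite -setX_bigcupr; exact: measurableX.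
Qed.

HB.instance Definition _ := isMeasure.Build _ _ _ (slice_measure mB)
  slice0 slice_ge0 slice_semi_sigma_additive.

Let slice_fin : fin_num_fun (slice_measure mB).
Proof. by move=> D mD; apply: fin_num_measure; exact: measurableX. Qed.

HB.instance Definition _ := Measure_isFinite.Build _ _ _ (slice_measure mB) slice_fin.

(** The conditional probability of [B] given the second coordinate, as a
    Radon-Nikodym density. *)
Lemma slice_density (nu : probability Z R) :
  (forall D, measurable D -> sigma (setT `*` D) = nu D) ->
  exists h : Z -> \bar R, [/\ forall z, (0 <= h z)%E, nu.-integrable setT h &
    forall D, measurable D -> sigma (B `*` D) = (\int[nu]_(z in D) h z)%E].
Proof.
move=> snu.
have dom : slice_measure mB `<< nu.
  apply/null_content_dominatesP => D mD nD.
  apply/eqP; rewrite eq_le measure_ge0 andbT.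
  rewrite -(_ : sigma (setT `*` D) = 0%E); last by rewrite snu.
  apply: measure_mono; [exact: measurableX|exact: measurableX|].
  by move=> [y z] [].
by have [h [h0 hfin hint hE]] := radon_nikodym_sigma_finite dom; exists h.
Qed.
End slice.

Section gluing.
Context (R : realType) (Y : completeMetricType R) d1 d2
  (Z : measurableType d1) (Om : measurableType d2).
Hypothesis sY : separable_space Y.
Variables (P : probability Om R) (psi : {mfun Om >-> Z})
  (sigma : probability (borel Y * Z)%type R).
Hypothesis psi_sigma :
  forall D, measurable D -> sigma (setT `*` D) = P (psi @^-1` D).

Let nu := distribution P psi.

(** With [h B z] the conditional probability of [B] given [z] under [sigma], the
    law to build gives [B * C] the mass [\int_C h B (psi w) dP(w)]: conditionally
    on [psi w], the new coordinate is independent of [w]. The densities are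
    additive in [B] only almost everywhere, which integration does not see;
    [bimeasure_extension] then replaces a disintegration of [sigma]. *)
Lemma gluing : exists L : probability (borel Y * Om)%type R,
  (forall C, measurable C -> L (setT `*` C) = P C) /\
  (forall B D, measurable B -> measurable D ->
    L (B `*` psi @^-1` D) = sigma (B `*` D)).
Proof.
have /choice[h Hh] : forall B : set (borel Y), exists h : Z -> \bar R,
    measurable B -> [/\ forall z, (0 <= h z)%E, nu.-integrable setT h &
    forall D, measurable D -> sigma (B `*` D) = (\int[nu]_(z in D) h z)%E].
  move=> B; have [mB|nB] := pselect (measurable B); last by exists (cst 0%E).
  by have [h hP] := slice_density mB (nu := nu) psi_sigma; exists h.
have h0 B z : measurable B -> (0 <= h B z)%E by move=> /Hh[].
have mh B : measurable B -> measurable_fun setT (h B).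
  by move=> /Hh[_ /measurable_int].
have hE B D : measurable B -> measurable D ->
    sigma (B `*` D) = (\int[nu]_(z in D) h B z)%E.
  by move=> /Hh[_ _]; apply.
have mpsi D : measurable D -> measurable (psi @^-1` D).
  exact: measurable_funPTI.
have mhpsi B C : measurable B -> measurable_fun C (h B \o psi).
  move=> mB; apply: measurable_funTS; apply: measurableT_comp => //.
  exact: mh.
pose I B C := (\int[P]_(x in C) h B (psi x))%E.
have I0 B C : measurable B -> (0 <= I B C)%E.
  by move=> mB; apply: integral_ge0 => x _; exact: h0.
have Ipsi B D : measurable B -> measurable D -> I B (psi @^-1` D) = sigma (B `*` D).
  move=> mB mD; rewrite hE// /nu ge0_integral_pushforward//.
  - exact: measurable_funTS (mh _ mB).
  - by move=> z _; exact: h0.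
have IT B : measurable B -> I B setT = sigma (B `*` setT).
  by move=> mB; rewrite -Ipsi.
have I_mono B C : measurable B -> measurable C -> (I B C <= I B setT)%E.
  move=> mB mC; apply: ge0_subset_integral => //; first exact: mhpsi.
  by move=> x _; exact: h0.
have Ifin B C : measurable B -> measurable C -> I B C \is a fin_num.
  move=> mB mC; rewrite ge0_fin_numE; last exact: I0.
  apply: le_lt_trans (I_mono _ _ mB mC) _; rewrite IT// ltey_eq.
  by rewrite fin_num_measure//; exact: measurableX.
have ae_psi (f g : Z -> \bar R) : ae_eq nu setT f g ->
    forall C, ae_eq P C (f \o psi) (g \o psi).
  move=> [N [mN N0 fgN]] C; exists (psi @^-1` N); split => //; first exact: mpsi.
  by move=> x /= fgx; apply: fgN => /= fg; apply: fgx => _; exact: fg.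
pose b (B : set (borel Y)) (C : set Om) : R := fine (I B C).
have bE B C : measurable B -> measurable C -> (b B C)%:E = I B C.
  by move=> mB mC; rewrite /b fineK// Ifin.
have hU A A' : measurable A -> measurable A' -> A `&` A' = set0 ->
    ae_eq nu setT (h (A `|` A')) (fun z => h A z + h A' z)%E.
  move=> mA mA' AA'; have mAA' := measurableU _ _ mA mA'.
  have [_ iAA' _] := Hh _ mAA'.
  apply: integral_ae_eq => //.
    by apply: emeasurable_funD; exact: mh.
  move=> E _ mE; rewrite -hE//.
  rewrite ge0_integralD//; last 4 first.
  - by move=> z _; exact: h0.
  - exact: measurable_funTS (mh _ mA).
  - by move=> z _; exact: h0.
  - exact: measurable_funTS (mh _ mA').
  by rewrite -!hE// measure_rectangleUl.
have hT : ae_eq nu setT (h setT) (cst 1%E).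
  have [_ iT _] := Hh _ measurableT.
  apply: integral_ae_eq => // E _ mE; rewrite -hE// psi_sigma//.
  by rewrite integral_cst// mul1e.
have bUl A A' C : measurable A -> measurable A' -> measurable C ->
    A `&` A' = set0 -> b (A `|` A') C = b A C + b A' C.
  move=> mA mA' mC AA'; have mAA' := measurableU _ _ mA mA'.
  apply: EFin_inj; rewrite EFinD !bE// /I -ge0_integralD//; last 4 first.
  - by move=> x _; exact: h0.
  - exact: mhpsi.
  - by move=> x _; exact: h0.
  - exact: mhpsi.
  apply: ge0_ae_eq_integral => //.
  - exact: mhpsi.
  - by apply: emeasurable_funD; exact: mhpsi.
  - by move=> x _; exact: h0.
  - by move=> x _; apply: adde_ge0; exact: h0.
  - exact: ae_psi (hU _ _ mA mA' AA') C.
have bUr A C C' : measurable A -> measurable C -> measurable C' ->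
    C `&` C' = set0 -> b A (C `|` C') = b A C + b A C'.
  move=> mA mC mC' CC'; have mCC' := measurableU _ _ mC mC'.
  apply: EFin_inj; rewrite EFinD !bE// /I ge0_integral_setU//.
  - exact: mhpsi.
  - by move=> x _; exact: h0.
  - exact/disj_set2P.
have bT C : measurable C -> (b setT C)%:E = P C.
  move=> mC; rewrite bE// /I.
  rewrite (ge0_ae_eq_integral (g := cst 1%E))//.
  - by rewrite integral_cst// mul1e.
  - exact: mhpsi.
  - by move=> x _; exact: h0.
  - exact: ae_psi hT C.
pose pY := mkmfun (@measurable_fst _ _ (borel Y) Z).
have [| |L HL] := bimeasure_extension (mu := distribution sigma pY) (nu := P) sY _ bUl bUr _ bT.
- by move=> A C mA mC; rewrite -lee_fin bE// I0.
- by move=> A mA; rewrite bE// IT// setXT.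
exists L; split => [C mC|B D mB mD]; first by rewrite HL// bT.
by rewrite HL ?bE ?Ipsi//; exact: mpsi.
Qed.
End gluing.

(** * Measurability of distances, cells and limits *)

Section metric_measurability.
Context (R : realType) (X : completeMetricType R) (sX : separable_space X).

Lemma measurable_mdistl (a : X) :
  measurable_fun setT (mdist a : borel X -> R).
Proof.
move=> mT; apply: (measurability _ (RGenInftyO.measurableE R)) => //.
move=> _ [_ [r ->] <-]; rewrite setTI; apply: measurable_open.
rewrite (_ : _ @^-1` _ = [set x | mdist a x < r]); first exact: open_mdist_lt.
by apply/seteqP; split => x /=; rewrite in_itv.
Qed.

(** Separability expresses [d x y < r] as a countable union of conditions
    [d (a n) x + d (a n) y < r], each measurable for the product sigma-algebra. *)
Lemma measurable_mdist :
  measurable_fun setT (fun w : borel X * borel X => mdist (w.1 : X) w.2 : R).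
Proof.
have [a ha] := separable_seq sX.
move=> mT; apply: (measurability _ (RGenInftyO.measurableE R)) => //.
move=> _ [_ [r ->] <-]; rewrite setTI.
rewrite (_ : _ @^-1` _ = \bigcup_n
  [set w : borel X * borel X | mdist (a n) w.1 + mdist (a n) w.2 < r]); last first.
  apply/seteqP; split => [[x y]|[x y] [n _]] /=; rewrite in_itv/=.
    move=> xy; have [|n nx] := ha x ((r - mdist x y) / 2).
      by rewrite divr_gt0// subr_gt0.
    exists n => //=; have := metric_triangle (a n) x y; lra.
  apply: le_lt_trans; rewrite (metric_sym (a n) x); exact: metric_triangle.
apply: bigcup_measurable => n _.
have mf : measurable_fun setT (fun w : borel X * borel X =>
    mdist (a n) (w.1 : X) + mdist (a n) (w.2 : X) : R).
  apply: measurable_funD.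
    by apply: (measurableT_comp (measurable_mdistl (a n))); exact: measurable_fst.
  by apply: (measurableT_comp (measurable_mdistl (a n))); exact: measurable_snd.
rewrite (_ : [set w | _] = setT `&` (fun w : borel X * borel X =>
    mdist (a n) (w.1 : X) + mdist (a n) (w.2 : X) : R) @^-1` `]-oo, r[%classic).
  by apply: mf => //; exact: measurable_itv.
by rewrite setTI; apply/seteqP; split => w /=; rewrite in_itv.
Qed.

Lemma mdist_quadrilateral (x x' y y' : X) :
  `|mdist x x' - mdist y y'| <= mdist x y + mdist x' y' :> R.
Proof.
have := metric_triangle x y x'; have := metric_triangle y y' x'.
have := metric_triangle y x y'; have := metric_triangle x x' y'.
rewrite (metric_sym y x) (metric_sym y' x') ler_norml => *.
by apply/andP; split; lra.
Qed.

(** A countable measurable partition into sets of diameter at most [2 * r]. *)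
Definition small_cell (a : nat -> X) (r : R) : nat -> set (borel X) :=
  seqDU (fun i => [set x | mdist (a i) x < r]).

Lemma measurable_small_cell a r i : measurable (small_cell a r i).
Proof.
apply: measurableD; first by apply: measurable_open; exact: open_mdist_lt.
by apply: bigsetU_measurable => k _; apply: measurable_open; exact: open_mdist_lt.
Qed.

Lemma small_cell_lt a r i x : small_cell a r i x -> mdist (a i) (x : X) < r.
Proof. by case. Qed.

Lemma small_cell_inj a r i j x : small_cell a r i x -> small_cell a r j x -> i = j.
Proof.
move=> xi xj; apply: contrapT => /eqP ij.
have /trivIsetP/(_ i j Logic.I Logic.I ij) :=
  @trivIset_seqDU X (fun i => [set x | mdist (a i) x < r]).
by move=> /seteqP[/(_ x) + _]; apply; split.
Qed.

Lemma small_cell_cover a r (x : X) : 0 < r ->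
  (forall x (e : R), 0 < e -> exists n, mdist (a n) x < e) ->
  exists i, small_cell a r i x.
Proof.
move=> r0 /(_ x _ r0)[n nx].
have : (\bigcup_k [set x | mdist (a k) x < r]) x by exists n.
by rewrite seqDU_bigcup_eq => -[i _ xi]; exists i.
Qed.

End metric_measurability.

Section ultrafilter_limits.
Context (R : realType) (G : set_system nat) (UG : UltraFilter G).

Lemma ultra_bounded_cvg (u : nat -> R) : (forall n, 0 <= u n <= 1) ->
  exists l : R, u @ G --> l.
Proof.
move=> u01; have pG : ProperFilter (u @ G) by exact: fmap_proper_filter.
have [|p [_ clp]] := @segment_compact R 0 1 (u @ G) pG.
  suff : G (u @^-1` `[0, 1]%classic) by [].
  by apply: filterS filterT => n _ /=; rewrite in_itv /=.
exists p => V Vp; have [//|nV] := in_ultra_setVsetC (u @^-1` V) UG.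
have [x [nVx Vx]] := clp (~` V) V nV Vp; contradiction.
Qed.

Lemma cvg_finite_sum (I : finType) (u : I -> nat -> R) (l : I -> R) :
  (forall i, u i @ G --> l i) -> (fun n => \sum_i u i n) @ G --> \sum_i l i.
Proof.
move=> ul; elim: (index_enum I) => [|i s IH].
  by rewrite big_nil; under eq_fun do rewrite big_nil; exact: cvg_cst.
rewrite big_cons; under eq_fun do rewrite big_cons.
exact: cvgD.
Qed.
End ultrafilter_limits.

Section liminf.
Context d (T : measurableType d) (R : realType) (mu : probability T R).
Local Open Scope ereal_scope.

Lemma limn_einf_ge (u : nat -> \bar R) (x : \bar R) N :
  (forall n, (N <= n)%N -> x <= u n) -> x <= limn_einf u.
Proof.
move=> xu; rewrite limn_einf_lim; apply: lime_ge; first exact: is_cvg_einfs.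
exists N => // n /= Nn; apply: le_ereal_inf_tmp => _ [m /= nm <-].
by apply: xu; exact: leq_trans nm.
Qed.

Lemma integral_liminf_le (f : T -> \bar R) (g : nat -> T -> \bar R) (L : \bar R) :
  (forall x, 0 <= f x) -> measurable_fun setT f ->
  (forall n x, 0 <= g n x) -> (forall n, measurable_fun setT (g n)) ->
  (forall x, f x <= limn_einf (g ^~ x)) ->
  (forall n, \int[mu]_x g n x <= L) -> \int[mu]_x f x <= L.
Proof.
move=> f0 mf g0 mg fg gL.
apply: (@le_trans _ _ (\int[mu]_x limn_einf (g ^~ x))).
  apply: ge0_le_integral => //.
  rewrite /limn_einf; apply: measurableT_comp => //.
  apply: measurable_fun_limn_esup => n.
  by apply: measurableT_comp => //; exact: mg.
apply: (le_trans (fatou _ measurableT mg _)) => //.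
rewrite limn_einf_lim; apply: lime_le; first exact: is_cvg_einfs.
apply: nearW => n; apply: le_trans (gL n).
by apply: ereal_inf_lbound; exists n => /=.
Qed.
End liminf.

(** * Limits of couplings *)

Section coupling_limit.
Context (R : realType) (X Y : mmspace R).
Implicit Type pi : probability (borel X * borel Y)%type R.

Lemma couplingsP pi : couplings X Y pi <->
  (forall A : set (borel X), measurable A -> pi (A `*` setT) = mm_meas X A) /\
  (forall B : set (borel Y), measurable B -> pi (setT `*` B) = mm_meas Y B).
Proof.
by split => -[H1 H2]; split => [A mA|B mB]; rewrite -?H1 -?H2// ?setXT ?setTX.
Qed.

(** Limits along an ultrafilter of the masses of all rectangles exist at once and
    are additive in each side. Their marginals are those of the couplings, so
    that they extend to a measure. *)
Lemma coupling_ultralimit (G : set_system nat) (UG : UltraFilter G)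
    (pi_ : nat -> probability (borel X * borel Y)%type R) :
  (forall n, couplings X Y (pi_ n)) ->
  exists pi, couplings X Y pi /\ forall A B, measurable A -> measurable B ->
    (fun n => fine (pi_ n (A `*` B))) @ G --> (fine (pi (A `*` B)) : R).
Proof.
move=> cpi.
pose u (A : set (borel X)) (B : set (borel Y)) n : R := fine (pi_ n (A `*` B)).
have uE A B n : measurable A -> measurable B -> (u A B n)%:E = pi_ n (A `*` B).
  by move=> mA mB; rewrite /u fineK// fin_num_measure//; exact: measurableX.
have /choice[b0 Hb0] : forall AB : set (borel X) * set (borel Y), exists l : R,
    measurable AB.1 -> measurable AB.2 -> u AB.1 AB.2 @ G --> l.
  move=> [A B] /=; have [mA|] := pselect (measurable A); last by exists 0.
  have [mB|] := pselect (measurable B); last by exists 0.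
  have [|l ul] := ultra_bounded_cvg UG (u := u A B); last by exists l.
  move=> n; rewrite -!lee_fin uE// measure_ge0/=; apply: probability_le1.
  exact: measurableX.
pose b A B := b0 (A, B).
have ub A B : measurable A -> measurable B -> u A B @ G --> b A B.
  by move=> mA mB; exact: (Hb0 (A, B)).
have lim_eq (v : nat -> R) (l l' : R) : v @ G --> l -> v @ G --> l' -> l = l'.
  exact: cvg_unique.
have bmu A : measurable A -> (b A setT)%:E = mm_meas X A.
  move=> mA; rewrite (lim_eq _ _ (fine (mm_meas X A)) (ub _ _ mA measurableT)).
    by rewrite fineK// fin_num_measure.
  rewrite (_ : u A setT = cst (fine (mm_meas X A))); first exact: cvg_cst.
  apply/funext => n /=; have [/(_ A mA) + _] := (couplingsP _).1 (cpi n).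
  by rewrite /u => ->.
have bnu B : measurable B -> (b setT B)%:E = mm_meas Y B.
  move=> mB; rewrite (lim_eq _ _ (fine (mm_meas Y B)) (ub _ _ measurableT mB)).
    by rewrite fineK// fin_num_measure.
  rewrite (_ : u setT B = cst (fine (mm_meas Y B))); first exact: cvg_cst.
  apply/funext => n /=; have [_ /(_ B mB) +] := (couplingsP _).1 (cpi n).
  by rewrite /u => ->.
have [pi piE] : exists pi : probability (borel X * borel Y)%type R,
    forall A B, measurable A -> measurable B -> pi (A `*` B) = (b A B)%:E.
  apply: (bimeasure_extension (mu := mm_meas X) (nu := mm_meas Y)) => //.
  - exact: mm_separable.
  - move=> A B mA mB; apply: (cvgr_to_ge (ub _ _ mA mB)).
    by apply: nearW => n; rewrite -lee_fin uE.
  - move=> A A' B mA mA' mB AA'; have mAA' := measurableU _ _ mA mA'.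
    apply: (lim_eq _ _ _ (ub _ _ mAA' mB)).
    rewrite (_ : u _ B = u A B \+ u A' B); first by apply: cvgD; exact: ub.
    apply/funext => n; apply: EFin_inj.
    by rewrite EFinD !uE// measure_rectangleUl.
  - move=> A B B' mA mB mB' BB'; have mBB' := measurableU _ _ mB mB'.
    apply: (lim_eq _ _ _ (ub _ _ mA mBB')).
    rewrite (_ : u A _ = u A B \+ u A B'); first by apply: cvgD; exact: ub.
    apply/funext => n; apply: EFin_inj.
    by rewrite EFinD !uE// measure_rectangleUr.
exists pi; split; last by move=> A B mA mB; rewrite piE//=; exact: ub.
by apply/couplingsP; split => [A mA|B mB]; rewrite piE// ?bmu ?bnu.
Qed.
End coupling_limit.

(** * Lower semicontinuity of the cost *)

Definition GW_cost (R : realType) (X Y : mmspace R)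
    (pi : probability (borel X * borel Y)%type R) : \bar R :=
  (\int[pi]_p \int[pi]_q
    (`| @mdist R X p.1 q.1 - @mdist R Y p.2 q.2 | ^+ 2)%:E)%E.

Section product_integrals.
Context d (T : measurableType d) (R : realType) (P : probability T R).
Local Open Scope ereal_scope.

Lemma integral_productE (f : T * T -> \bar R) :
  measurable_fun setT f -> (forall w, 0 <= f w) ->
  \int[P \x P]_w f w = \int[P]_p \int[P]_q f (p, q).
Proof. by move=> mf f0; rewrite fubini_tonelli1. Qed.

End product_integrals.

Section distortion.
Context (R : realType) (X Y : mmspace R).
Let T := (borel X * borel Y)%type.

Definition distortion (w : T * T) : R :=
  `| @mdist R X w.1.1 w.2.1 - @mdist R Y w.1.2 w.2.2 |.

Lemma distortion_ge0 w : 0 <= distortion w. Proof. exact: normr_ge0. Qed.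

Lemma measurable_distortion : measurable_fun setT distortion.
Proof.
have mX := measurable_mdist (@mm_separable _ X).
have mY := measurable_mdist (@mm_separable _ Y).
have m11 : measurable_fun setT (fun w : T * T => w.1.1).
  by apply: measurableT_comp; exact: measurable_fst.
have m21 : measurable_fun setT (fun w : T * T => w.2.1).
  by apply: measurableT_comp; [exact: measurable_fst|exact: measurable_snd].
have m12 : measurable_fun setT (fun w : T * T => w.1.2).
  by apply: measurableT_comp; [exact: measurable_snd|exact: measurable_fst].
have m22 : measurable_fun setT (fun w : T * T => w.2.2).
  by apply: measurableT_comp; exact: measurable_snd.
apply: (measurableT_comp (@normr_measurable R setT)); apply: measurable_funB.
  exact: measurableT_comp mX (measurable_fun_pair m11 m21).
exact: measurableT_comp mY (measurable_fun_pair m12 m22).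
Qed.

Lemma measurable_sqdistortion :
  measurable_fun setT (fun w => (distortion w ^+ 2)%:E).
Proof. by apply/measurable_EFinP/measurable_funX; exact: measurable_distortion. Qed.

Lemma GW_costE (pi : probability T R) :
  GW_cost pi = (\int[pi \x pi]_w (distortion w ^+ 2)%:E)%E.
Proof.
rewrite integral_productE//; first exact: measurable_sqdistortion.
by move=> w; rewrite lee_fin sqr_ge0.
Qed.

End distortion.

Section lower_semicontinuity.
Context (R : realType) (X Y : mmspace R).
Let T := (borel X * borel Y)%type.
Variables (a : nat -> X) (b : nat -> Y).
Hypothesis ha : forall x (e : R), 0 < e -> exists n, mdist (a n) x < e.
Hypothesis hb : forall y (e : R), 0 < e -> exists n, mdist (b n) y < e.

(** The positive part of [x - r]; it absorbs the error made on a distortion when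
    points are replaced by the centres of their cells. *)
Definition excess (r x : R) : R := Num.max 0 (x - r).

Lemma excess_ge0 r x : 0 <= excess r x.
Proof. by rewrite /excess le_max lexx. Qed.

Lemma le_excess r s x y : x - r <= y - s -> excess r x <= excess s y.
Proof. by move=> H; rewrite /excess ge_max !le_max lexx/= H orbT. Qed.

Lemma excess_le r x : 0 <= r -> 0 <= x -> excess r x <= x.
Proof. by move=> r0 x0; rewrite /excess ge_max x0/= gerBl. Qed.

Definition cell (r : R) (ij : nat * nat) : set T :=
  small_cell a r ij.1 `*` small_cell b r ij.2.

Lemma measurable_cell r ij : measurable (cell r ij).
Proof. by apply: measurableX; exact: measurable_small_cell. Qed.

Lemma cell_inj r ij kl p : cell r ij p -> cell r kl p -> ij = kl.
Proof.
case: ij kl => i j [k l] [/= pi pj] [/= pk pl].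
by rewrite (small_cell_inj pi pk) (small_cell_inj pj pl).
Qed.

Definition cell_weight (r : R) (s t : nat * nat) : R :=
  excess (4 * r) `|mdist (a s.1) (a t.1) - mdist (b s.2) (b t.2)| ^+ 2.

Lemma cell_distortion r s t w : cell r s w.1 -> cell r t w.2 ->
  `| `|mdist (a s.1) (a t.1) - mdist (b s.2) (b t.2)| - distortion w | <= 4 * r.
Proof.
move=> [/= s1 s2] [/= t1 t2].
apply: le_trans (ler_dist_dist _ _) _.
have := mdist_quadrilateral (a s.1) (a t.1) w.1.1 w.2.1.
have := mdist_quadrilateral (b s.2) (b t.2) w.1.2 w.2.2.
have := small_cell_lt s1; have := small_cell_lt s2.
have := small_cell_lt t1; have := small_cell_lt t2.
rewrite !ler_norml => *; lra.
Qed.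

(** A cost below the squared distortion that is constant on products of cells and
    vanishes outside finitely many of them: its integral is then a polynomial in
    the masses of finitely many rectangles, which passes to ultrafilter limits. *)
Definition step_cost (r : R) (N : nat) (w : T * T) : R :=
  \sum_(st : ('I_N * 'I_N) * ('I_N * 'I_N))
    cell_weight r (val st.1.1, val st.1.2) (val st.2.1, val st.2.2) *
    \1_(cell r (val st.1.1, val st.1.2) `*` cell r (val st.2.1, val st.2.2)) w.

Lemma step_cost_ge0 r N w : 0 <= step_cost r N w.
Proof. by apply: sumr_ge0 => st _; rewrite mulr_ge0// sqr_ge0. Qed.

Lemma step_cost_cell r N (i j k l : 'I_N) w :
  cell r (val i, val j) w.1 -> cell r (val k, val l) w.2 ->
  step_cost r N w = cell_weight r (val i, val j) (val k, val l).
Proof.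
move=> ijw klw; rewrite /step_cost (bigD1 ((i, j), (k, l)))//=.
rewrite indicE mem_set// mulr1 big1 ?addr0// => -[[i' j'] [k' l']] /= ne.
rewrite indicE memNset ?mulr0// => -[/= ijw' klw'].
move/negP: ne; apply; apply/eqP.
have [/val_inj -> /val_inj ->] := cell_inj ijw' ijw.
by have [/val_inj -> /val_inj ->] := cell_inj klw' klw.
Qed.

Lemma step_cost_le r N w : 0 <= r -> step_cost r N w <= distortion w ^+ 2.
Proof.
move=> r0.
have [[[[i j] [k l]] [/= ijw klw]]|nw] := pselect (exists st : ('I_N * 'I_N) * ('I_N * 'I_N),
  cell r (val st.1.1, val st.1.2) w.1 /\ cell r (val st.2.1, val st.2.2) w.2).
  rewrite (step_cost_cell ijw klw) /cell_weight.
  rewrite ler_sqr ?nnegrE ?excess_ge0 ?distortion_ge0//.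
  apply: (@le_trans _ _ (excess 0 (distortion w))); last first.
    by apply: excess_le => //; exact: normr_ge0.
  apply: le_excess; have := cell_distortion ijw klw; rewrite ler_norml/=; lra.
rewrite /step_cost big1 ?sqr_ge0// => st _.
by rewrite indicE memNset ?mulr0// => -[? ?]; apply: nw; exists st.
Qed.

Lemma step_cost_ge r w : 0 < r -> exists N0, forall N, (N0 <= N)%N ->
  excess (8 * r) (distortion w) ^+ 2 <= step_cost r N w.
Proof.
move=> r0.
have [i wi] := small_cell_cover w.1.1 r0 ha; have [j wj] := small_cell_cover w.1.2 r0 hb.
have [k wk] := small_cell_cover w.2.1 r0 ha; have [l wl] := small_cell_cover w.2.2 r0 hb.
exists (maxn (maxn i j) (maxn k l)).+1 => N; rewrite !gtn_max -!andbA => /and4P[iN jN kN lN].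
have ijw : cell r (val (Ordinal iN), val (Ordinal jN)) w.1 by [].
have klw : cell r (val (Ordinal kN), val (Ordinal lN)) w.2 by [].
rewrite (step_cost_cell ijw klw) ler_sqr ?nnegrE ?excess_ge0//.
apply: le_excess; have := cell_distortion ijw klw; rewrite ler_norml/=; lra.
Qed.

Lemma measurable_step_cost r N : measurable_fun setT (step_cost r N).
Proof.
apply: measurable_sum => st; apply: measurable_funM => //.
by apply: measurable_indic; apply: measurableX; exact: measurable_cell.
Qed.

Lemma integral_step_cost (pi : probability T R) r N :
  (\int[pi \x pi]_w (step_cost r N w)%:E)%E =
  (\sum_(st : ('I_N * 'I_N) * ('I_N * 'I_N))
    cell_weight r (val st.1.1, val st.1.2) (val st.2.1, val st.2.2) *
    (fine (pi (cell r (val st.1.1, val st.1.2))) *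
     fine (pi (cell r (val st.2.1, val st.2.2)))))%:E.
Proof.
under eq_integral do rewrite /step_cost -sumEFin.
rewrite ge0_integral_sum//; last 2 first.
- move=> st; apply/measurable_EFinP/measurable_funM => //.
  by apply: measurable_indic; apply: measurableX; exact: measurable_cell.
- by move=> st w _; rewrite lee_fin mulr_ge0// sqr_ge0.
rewrite -sumEFin; apply: eq_bigr => st _.
under eq_integral do rewrite EFinM.
rewrite ge0_integralZl//; last 2 first.
- by apply/measurable_EFinP/measurable_indic; apply: measurableX; exact: measurable_cell.
- by rewrite lee_fin sqr_ge0.
rewrite integral_indic//; last by apply: measurableX; exact: measurable_cell.
rewrite setIT [X in (_ * X)%E]product_measure1E; [|exact: measurable_cell|exact: measurable_cell].
by rewrite !EFinM !fineK// fin_num_measure//; exact: measurable_cell.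
Qed.

(** Fatou's lemma is used twice: as [N] grows the step costs of mesh [r] end up
    above the squared excess over [8 * r], and as [r] vanishes this excess
    recovers the squared distortion. *)
Lemma GW_cost_le_step (pi : probability T R) (L : \bar R) :
  (forall (r : R) N, 0 < r -> (\int[pi \x pi]_w (step_cost r N w)%:E <= L)%E) ->
  (GW_cost pi <= L)%E.
Proof.
move=> HL; rewrite GW_costE.
have mex r : measurable_fun setT (fun w => (excess r (@distortion _ X Y w) ^+ 2)%:E).
  apply/measurable_EFinP/measurable_funX; rewrite /excess.
  apply: measurable_maxr => //; apply: measurable_funB => //.
  exact: measurable_distortion.
have Hex r : 0 < r ->
    (\int[pi \x pi]_w (excess (8 * r) (distortion w) ^+ 2)%:E <= L)%E.
  move=> r0; apply: (integral_liminf_le (g := fun N w => (step_cost r N w)%:E)).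
  - by move=> w; rewrite lee_fin sqr_ge0.
  - exact: mex.
  - by move=> N w; rewrite lee_fin step_cost_ge0.
  - by move=> N; apply/measurable_EFinP; exact: measurable_step_cost.
  - move=> w; have [N0 HN0] := step_cost_ge w r0.
    by apply: (limn_einf_ge (N := N0)) => N /HN0; rewrite lee_fin.
  - by move=> N; exact: HL.
apply: (integral_liminf_le
    (g := fun n w => (excess (8 * n.+1%:R^-1) (distortion w) ^+ 2)%:E)).
- by move=> w; rewrite lee_fin sqr_ge0.
- exact: measurable_sqdistortion.
- by move=> N w; rewrite lee_fin sqr_ge0.
- by move=> N; exact: mex.
- move=> w.
  suff H : (excess (8 * n.+1%:R^-1) (distortion w) ^+ 2)%:E @[n --> \oo] -->
      (distortion w ^+ 2)%:E by have [-> _] := cvg_limn_einf_sup H.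
  apply/cvg_EFin; first exact: nearW.
  set d := distortion w.
  have dn : excess (8 * n.+1%:R^-1) d @[n --> \oo] --> d.
    apply: (@squeeze_cvgr _ _ _ _ (fun n => d - 8 * n.+1%:R^-1) (cst d)).
    - apply: nearW => n; rewrite excess_le ?andbT; last exact: distortion_ge0.
        by rewrite /excess le_max lexx orbT.
      by rewrite mulr_ge0// invr_ge0.
    - rewrite -[X in _ --> X]subr0 -[X in _ --> _ - X](mulr0 8).
      by apply: cvgB; [exact: cvg_cst|apply: cvgMl_tmp; exact: cvg_harmonic].
    - exact: cvg_cst.
  by rewrite expr2; under eq_fun do rewrite /= expr2; exact: cvgM.
- by move=> n; apply: Hex; rewrite invr_gt0.
Qed.
End lower_semicontinuity.

(** * Existence of optimal couplings *)

Section optimal_coupling.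
Context (R : realType) (X Y : mmspace R).

Lemma GW2_mm_le (pi : probability (borel X * borel Y)%type R) :
  couplings X Y pi -> (GW2_mm X Y <= GW_cost pi)%E.
Proof. by move=> cpi; apply: ereal_inf_lbound; exists pi. Qed.

Lemma GW_cost_ge0 (pi : probability (borel X * borel Y)%type R) :
  (0 <= GW_cost pi)%E.
Proof.
by apply: integral_ge0 => p _; apply: integral_ge0 => q _; rewrite lee_fin sqr_ge0.
Qed.

Lemma GW2_mm_ge0 : (0 <= GW2_mm X Y)%E.
Proof. by apply: le_ereal_inf_tmp => _ [pi _ <-]; exact: GW_cost_ge0. Qed.

(** A limit of a minimizing sequence along an ultrafilter finer than the
    neighbourhoods of infinity is optimal: each step cost has the limit of its
    integrals as integral, and these are bounded by the costs of the sequence. *)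
Lemma optimal_coupling : GW2_mm X Y \is a fin_num ->
  exists pi, couplings X Y pi /\ GW_cost pi = GW2_mm X Y.
Proof.
move=> fGW; set l := fine (GW2_mm X Y).
have lE : GW2_mm X Y = l%:E by rewrite /l fineK.
have /choice[pi_ Hpi] : forall n : nat, exists pi, couplings X Y pi /\
    (GW_cost pi <= (l + n.+1%:R^-1)%:E)%E.
  move=> n; have n0 : 0 < n.+1%:R^-1 :> R by rewrite invr_gt0.
  have [_ [pi cpi <-] Hpi] := lb_ereal_inf_adherent n0 fGW.
  exists pi; split => //; apply: ltW; apply: lt_le_trans Hpi _.
  by rewrite EFinD -lE.
have [G [UG sG]] := ultraFilterLemma eventually_filter.
have [pi [cpi piG]] := coupling_ultralimit UG (fun n => (Hpi n).1).
exists pi; split => //; apply/eqP; rewrite eq_le GW2_mm_le// andbT lE.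
have [a ha] := separable_seq (@mm_separable _ X).
have [b hb] := separable_seq (@mm_separable _ Y).
apply: (GW_cost_le_step ha hb) => r N r0.
have step_pi n := integral_step_cost a b (pi_ n) r N.
rewrite integral_step_cost lee_fin; apply/ler_addgt0Pr => e e0.
apply: (cvgr_to_le (F := G)).
  apply: cvg_finite_sum => st.
  apply: cvgMl_tmp; apply: cvgM; apply: piG; exact: measurable_small_cell.
have [n0 _ Hn0] := near_infty_natSinv_lt (PosNum e0).
apply: sG; exists n0 => // n /Hn0 /= ne.
rewrite -lee_fin -step_pi.
apply: (@le_trans _ _ (GW_cost (pi_ n))).
  rewrite GW_costE; apply: ge0_le_integral => //.
  - by move=> w _; rewrite lee_fin step_cost_ge0.
  - by apply/measurable_EFinP; exact: measurable_step_cost.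
  - exact: measurable_sqdistortion.
  - by move=> w _; rewrite lee_fin step_cost_le// ltW.
by apply: (le_trans (Hpi n).2); rewrite lee_fin lerD2l ltW.
Qed.
End optimal_coupling.

(** * The interpolated distance on a closed subset of a product *)

Section interpolation_space.
Context (R : realType) (X0 X1 : completeMetricType R) (s : R) (S : set (X0 * X1)).
Hypothesis s01 : 0 < s < 1.
Hypothesis S0 : S !=set0.
Hypothesis Scl : forall p, ~ S p -> exists2 e : R, 0 < e &
  forall q, mdist p.1 q.1 < e -> mdist p.2 q.2 < e -> ~ S q.

(** The carrier is a subset [S] of the product because full support is required.
    The hypothesis [Scl] says that [S] is closed, in terms of the two distances. *)
Definition interp_space : Type := {p : X0 * X1 | S p}.

HB.instance Definition _ := gen_eqMixin interp_space.
HB.instance Definition _ := gen_choiceMixin interp_space.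
HB.instance Definition _ := isPointed.Build interp_space (exist _ (get S) (getPex S0)).

Definition interp_dist (z w : interp_space) : R :=
  (1 - s) * mdist (sval z).1 (sval w).1 + s * mdist (sval z).2 (sval w).2.

Let s_gt0 : 0 < s. Proof. by case/andP: s01. Qed.
Let s_lt1 : 0 < 1 - s. Proof. by case/andP: s01; rewrite subr_gt0. Qed.

Let interp_distxx z : interp_dist z z = 0.
Proof. by rewrite /interp_dist !mdistxx !mulr0 addr0. Qed.

Let interp_dist_eq0 z w : interp_dist z w = 0 -> z = w.
Proof.
move=> /eqP; rewrite paddr_eq0 ?mulr_ge0 ?mdist_ge0 ?ltW//.
rewrite !mulf_eq0 (gt_eqF s_gt0) (gt_eqF s_lt1) /= => /andP[/eqP zw0 /eqP zw1].
case: z w zw0 zw1 => [[z0 z1] Sz] [[w0 w1] Sw] /= zw0 zw1.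
move: Sz Sw; rewrite (mdist_positivity _ _ zw0) (mdist_positivity _ _ zw1) => Sz Sw.
by congr (exist _ _ _); exact: Prop_irrelevance.
Qed.

Let interp_dist_sym z w : interp_dist z w = interp_dist w z.
Proof.
by rewrite /interp_dist (metric_sym (sval z).1) (metric_sym (sval z).2).
Qed.

Let interp_dist_triangle y x z :
  interp_dist x z <= interp_dist x y + interp_dist y z.
Proof.
rewrite /interp_dist addrACA -!mulrDr lerD// ler_pM2l//; exact: metric_triangle.
Qed.

HB.instance Definition _ := isMetric.Build R interp_space
  interp_distxx interp_dist_eq0 interp_dist_sym interp_dist_triangle.

Lemma ball_interpE (z : interp_space) (e : R) :
  ball z e = [set w | interp_dist z w < e].
Proof. by rewrite ballEmdist. Qed.

Let cauchy_fst (F : set_system interp_space) (FF : ProperFilter F) :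
  cauchy F -> cvg ((fun z : interp_space => (sval z).1) @ F).
Proof.
move=> /cauchyP cF; apply: cauchy_cvg; apply: cauchy_exP => e e0.
have [z Fz] := cF ((1 - s) * e) (mulr_gt0 s_lt1 e0); exists (sval z).1.
suff : F ((fun w : interp_space => (sval w).1) @^-1` ball (sval z).1 e) by [].
apply: filterS Fz => w; rewrite ball_interpE ballEmdist /= /interp_dist => zw.
rewrite -(ltr_pM2l s_lt1); apply: le_lt_trans zw.
by rewrite lerDl mulr_ge0 ?mdist_ge0// ltW.
Qed.

Let cauchy_snd (F : set_system interp_space) (FF : ProperFilter F) :
  cauchy F -> cvg ((fun z : interp_space => (sval z).2) @ F).
Proof.
move=> /cauchyP cF; apply: cauchy_cvg; apply: cauchy_exP => e e0.
have [z Fz] := cF (s * e) (mulr_gt0 s_gt0 e0); exists (sval z).2.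
suff : F ((fun w : interp_space => (sval w).2) @^-1` ball (sval z).2 e) by [].
apply: filterS Fz => w; rewrite ball_interpE ballEmdist /= /interp_dist => zw.
rewrite -(ltr_pM2l s_gt0); apply: le_lt_trans zw.
by rewrite lerDr mulr_ge0 ?mdist_ge0// ltW.
Qed.

Let interp_cauchy_cvg (F : set_system interp_space) :
  ProperFilter F -> cauchy F -> cvg F.
Proof.
move=> FF cF.
have /cvg_ex[p0 /cvg_ball Fp0] := cauchy_fst FF cF.
have /cvg_ex[p1 /cvg_ball Fp1] := cauchy_snd FF cF.
have Sp : S (p0, p1).
  apply: contrapT => /Scl[e e0 He].
  have [z [/=]] := filter_ex (filterI (Fp0 e e0) (Fp1 e e0)).
  rewrite !ballEmdist /= => z0 z1.
  exact: (He (sval z) z0 z1 (svalP z)).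
apply/cvg_ex; exists (exist _ (p0, p1) Sp : interp_space).
move=> W /nbhs_ballP[e /= e0 eW].
apply: filterS (filterI (Fp0 e e0) (Fp1 e e0)) => z [/=].
rewrite !ballEmdist /= => z0 z1; apply: eW.
rewrite ball_interpE /interp_dist /=.
have : (1 - s) * mdist p0 (sval z).1 < (1 - s) * e by rewrite ltr_pM2l.
have : s * mdist p1 (sval z).2 < s * e by rewrite ltr_pM2l.
rewrite /interp_dist /=; lra.
Qed.

HB.instance Definition _ := Uniform_isComplete.Build interp_space interp_cauchy_cvg.

Definition interp_metric : completeMetricType R := interp_space.

End interpolation_space.

(** * The interpolating metric measure space *)

(** In a separable space every open set is a countable union of balls. *)
Lemma measurable_fun_borel d (T : measurableType d) (R : realType)
    (Z : completeMetricType R) (f : T -> borel Z) :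
  separable_space Z ->
  (forall (z : Z) (e : R), measurable (f @^-1` [set w | mdist z w < e])) ->
  measurable_fun setT f.
Proof.
move=> sZ mf; have [a ha] := separable_seq sZ.
apply: (@measurability _ _ T (borel Z) setT f (@open Z) erefl) => _ [U oU <-]; rewrite setTI.
pose B n k := [set w : Z | mdist (a n) w < k.+1%:R^-1 :> R].
rewrite (_ : f @^-1` U = \bigcup_n \bigcup_(k in [set k | B n k `<=` U]) f @^-1` B n k).
  apply: bigcup_measurable => n _; apply: bigcup_measurable => k _; exact: mf.
apply/seteqP; split => [t Uft|t [n _ [k /= BU]]]; last exact: BU.
pose x : Z := f t.
have [e e0 eU] := (open_mdistP U).1 oU x Uft.
have e2 : 0 < e / 2 by rewrite divr_gt0.
have [k ke] := exists_invS_lt e2.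
have k0 : 0 < k.+1%:R^-1 :> R by rewrite invr_gt0.
have [n nx] := ha x _ k0.
exists n => //; exists k => //= w nw; apply: eU.
have := metric_triangle x (a n) w; rewrite (metric_sym x (a n)).
move: nw ke nx; rewrite /B /=; set r := _^-1; lra.
Qed.

Lemma measure_bigcup0 d (T : measurableType d) (R : realType) (mu : probability T R)
    (D : nat -> set T) : (forall k, measurable (D k)) -> (forall k, mu (D k) = 0%E) ->
  mu (\bigcup_k D k) = 0%E.
Proof.
move=> mD D0; apply/eqP; rewrite eq_le measure_ge0 andbT.
by apply: measure_bigcup_geometric => // k; rewrite D0 mul0r.
Qed.

Section interpolation.
Context (R : realType) (X0 X1 : completeMetricType R) (s : R).
Hypotheses (s01 : 0 < s < 1) (sX0 : separable_space X0) (sX1 : separable_space X1).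
Variable gam : probability (borel X0 * borel X1)%type R.
Variables (a0 : nat -> X0) (a1 : nat -> X1).
Hypothesis ha0 : forall x (e : R), 0 < e -> exists n, mdist (a0 n) x < e.
Hypothesis ha1 : forall x (e : R), 0 < e -> exists n, mdist (a1 n) x < e.

(** These products of balls form a countable base of the product; the support of
    [gam] is the complement [S] of the union [Sc] of those of mass zero. *)
Let B i j n : set (borel X0 * borel X1) :=
  [set x | mdist (a0 i) x < n.+1%:R^-1 :> R] `*` [set x | mdist (a1 j) x < n.+1%:R^-1 :> R].

Let mB i j n : measurable (B i j n).
Proof. by apply: measurableX; apply: measurable_open; exact: open_mdist_lt. Qed.

Let N i j n := if `[< gam (B i j n) = 0%E >] then B i j n else set0.

Let mN i j n : measurable (N i j n).
Proof. by rewrite /N; case: ifP. Qed.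

Let N0 i j n : gam (N i j n) = 0%E.
Proof. by rewrite /N; case: ifPn => [/asboolP//|]; rewrite measure0. Qed.

Let Sc := \bigcup_i \bigcup_j \bigcup_n N i j n.

Let mSc : measurable Sc.
Proof. by do 3 (apply: bigcup_measurable => ? _). Qed.

Let Sc0 : gam Sc = 0%E.
Proof.
apply: measure_bigcup0 => i; first by do 2 (apply: bigcup_measurable => ? _).
apply: measure_bigcup0 => j; first by apply: bigcup_measurable => ? _.
by apply: measure_bigcup0.
Qed.

Let S : set (X0 * X1) := ~` Sc.

Let S_neq0 : S !=set0.
Proof.
apply/set0P/eqP => S0; have : gam (Sc `|` S) = 1%E.
  by rewrite setUv probability_setT.
rewrite S0 setU0 Sc0 => /eqP.
by rewrite eq_sym onee_eq0.
Qed.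

Let S_closed p : ~ S p -> exists2 e : R, 0 < e &
  forall q, mdist p.1 q.1 < e -> mdist p.2 q.2 < e -> ~ S q.
Proof.
move=> /contrapT [i _ [j _ [n _ Np]]].
have : B i j n p by move: Np; rewrite /N; case: ifP.
move=> [/= p0 p1]; set r : R := n.+1%:R^-1 in p0 p1.
exists (Num.min (r - mdist (a0 i) p.1) (r - mdist (a1 j) p.2)).
  by rewrite lt_min !subr_gt0 p0 p1.
move=> q; rewrite !lt_min => /andP[q0 _] /andP[_ q1]; apply.
exists i => //; exists j => //; exists n => //.
suff : B i j n q by move: Np; rewrite /N; case: ifP.
split => /=; rewrite -/r.
  have := metric_triangle (a0 i) p.1 q.1; lra.
have := metric_triangle (a1 j) p.2 q.2; lra.
Qed.

Let Z := interp_metric s01 S_neq0 S_closed.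

Let pt (z : Z) : X0 * X1 := sval z.

Let s_gt0 : 0 < s. Proof. by case/andP: s01. Qed.
Let s_lt1 : 0 < 1 - s. Proof. by case/andP: s01; rewrite subr_gt0. Qed.

Let mdistZ (z w : Z) :
  mdist z w = (1 - s) * mdist (pt z).1 (pt w).1 + s * mdist (pt z).2 (pt w).2.
Proof. by []. Qed.

Let mdistZ_lt (z w : Z) (e : R) : mdist (pt z).1 (pt w).1 < e ->
  mdist (pt z).2 (pt w).2 < e -> mdist z w < e.
Proof.
rewrite mdistZ -(ltr_pM2l s_lt1) -(ltr_pM2l s_gt0 (mdist _ _)); lra.
Qed.

Let interp_separable : separable_space Z.
Proof.
pose c (t : nat * nat * nat) : Z := xget point
  [set z : Z | mdist (a0 t.1.1) (pt z).1 < t.2.+1%:R^-1 :> R /\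
           mdist (a1 t.1.2) (pt z).2 < t.2.+1%:R^-1 :> R].
exists (range c); split; first exact: sub_countable (card_image_le _ _) (countableP _).
move=> U [z Uz] oU; have [e e0 eU] := (open_mdistP U).1 oU _ Uz.
have e2 : 0 < e / 2 by rewrite divr_gt0.
have [n ne] := exists_invS_lt e2.
have n0 : 0 < n.+1%:R^-1 :> R by rewrite invr_gt0.
have [i iz] := ha0 (pt z).1 n0; have [j jz] := ha1 (pt z).2 n0.
exists (c (i, j, n)); split; last by exists (i, j, n).
apply: eU; rewrite /c; case: xgetP => [w _ [/= iw jw]|/(_ z)]; last by case.
move: ne iz jz iw jw; set r := _^-1 => ne iz jz iw jw.
apply: mdistZ_lt.
  have := metric_triangle (pt z).1 (a0 i) (pt w).1; rewrite (metric_sym _ (a0 i)); lra.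
have := metric_triangle (pt z).2 (a1 j) (pt w).2; rewrite (metric_sym _ (a1 j)); lra.
Qed.

(** The retraction onto the support, which transports [gam] to [Z]. *)
Let toZ (p : borel X0 * borel X1) : borel Z :=
  match pselect (S p) with left Sp => exist _ p Sp | right _ => point end.

Let toZK p : S p -> pt (toZ p) = p.
Proof. by rewrite /toZ; case: pselect. Qed.

Let toZ_point p : ~ S p -> toZ p = point.
Proof. by rewrite /toZ; case: pselect. Qed.

Let mS : measurable (S : set (borel X0 * borel X1)).
Proof. exact: measurableC. Qed.

Let measurable_toZ : measurable_fun setT toZ.
Proof.
apply: measurable_fun_borel; first exact: interp_separable.
move=> z e.
pose f (p : borel X0 * borel X1) : R :=
  (1 - s) * mdist (pt z).1 p.1 + s * mdist (pt z).2 p.2.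
have mf : measurable_fun setT f.
  apply: measurable_funD; apply: measurable_funM => //.
    exact: measurableT_comp (measurable_mdistl _) measurable_fst.
  exact: measurableT_comp (measurable_mdistl _) measurable_snd.
rewrite (_ : _ @^-1` _ = (S `&` f @^-1` `]-oo, e[%classic) `|`
   (~` S `&` [set _ | mdist z (point : Z) < e])); last first.
  apply/seteqP; split => [p /= pe|p /= [[Sp]|[nSp]]].
  - have [Sp|nSp] := pselect (S p); [left|right]; split => //.
      by move: pe; rewrite /= in_itv /= mdistZ toZK.
    by move: pe; rewrite toZ_point.
  - by rewrite in_itv /= mdistZ toZK.
  - by rewrite toZ_point.
apply: measurableU; apply: measurableI => //.
- by rewrite -[X in measurable X]setTI; apply: mf => //; exact: measurable_itv.
- exact: measurableC.
- have [ze|nze] := pselect (mdist z (point : Z) < e).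
    by rewrite (_ : [set _ | _] = setT)//; apply/seteqP; split.
  by rewrite (_ : [set _ | _] = set0)//; apply/seteqP; split.
Qed.

Let mm := distribution gam (mkmfun measurable_toZ).

Let mm_full : measure_support mm = [set: Z].
Proof.
apply/seteqP; split => // z _ U oU Uz.
have [e e0 eU] := (open_mdistP U).1 oU _ Uz.
have e2 : 0 < e / 2 by rewrite divr_gt0.
have [n ne] := exists_invS_lt e2.
have n0 : 0 < n.+1%:R^-1 :> R by rewrite invr_gt0.
have [i iz] := ha0 (pt z).1 n0; have [j jz] := ha1 (pt z).2 n0.
have Bz : B i j n (pt z) by [].
have gB : (0 < gam (B i j n))%E.
  rewrite lt_neqAle measure_ge0 andbT eq_sym; apply/eqP => gB0.
  apply: (svalP z); exists i => //; exists j => //; exists n => //.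
  by rewrite /N gB0; case: asboolP.
apply: (lt_le_trans gB).
apply: (@le_trans _ _ (gam ((toZ @^-1` U) `|` Sc))); last first.
  apply: (@le_trans _ _ (gam (toZ @^-1` U) + gam Sc)%E); last by rewrite Sc0 adde0.
  apply: measureU2 => //; rewrite -[X in measurable X]setTI.
  by apply: measurable_toZ => //; exact: measurable_open.
apply: measure_mono => //.
  apply: measurableU => //.
  rewrite -[X in measurable X]setTI; apply: measurable_toZ => //.
  exact: measurable_open.
move=> p [/= iw jw]; have [Sp|nSp] := pselect (S p); last by right; apply: contrapT.
left; apply: eU.
move: ne iz jz iw jw; set r := _^-1 => ne iz jz iw jw.
apply: mdistZ_lt; rewrite toZK//.
  have := metric_triangle (pt z).1 (a0 i) p.1; rewrite (metric_sym _ (a0 i)); lra.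
have := metric_triangle (pt z).2 (a1 j) p.2; rewrite (metric_sym _ (a1 j)); lra.
Qed.

Let Zmm : mmspace R := MMSpace interp_separable mm_full.

Let measurable_pt1 : measurable_fun setT (fun z : borel Z => (pt z).1 : borel X0).
Proof.
apply: measurable_fun_borel => // x e; apply: measurable_open.
apply/open_mdistP => z /= xz; exists ((1 - s) * (e - mdist x (pt z).1)).
  by rewrite mulr_gt0// subr_gt0.
move=> w; rewrite mdistZ => zw.
have : (1 - s) * mdist (pt z).1 (pt w).1 < (1 - s) * (e - mdist x (pt z).1).
  by apply: le_lt_trans zw; rewrite lerDl mulr_ge0 ?mdist_ge0// ltW.
rewrite ltr_pM2l// => H; have := metric_triangle x (pt z).1 (pt w).1; lra.
Qed.

Let measurable_pt2 : measurable_fun setT (fun z : borel Z => (pt z).2 : borel X1).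
Proof.
apply: measurable_fun_borel => // x e; apply: measurable_open.
apply/open_mdistP => z /= xz; exists (s * (e - mdist x (pt z).2)).
  by rewrite mulr_gt0// subr_gt0.
move=> w; rewrite mdistZ => zw.
have : s * mdist (pt z).2 (pt w).2 < s * (e - mdist x (pt z).2).
  by apply: le_lt_trans zw; rewrite lerDr mulr_ge0 ?mdist_ge0// ltW.
rewrite ltr_pM2l// => H; have := metric_triangle x (pt z).2 (pt w).2; lra.
Qed.

Lemma interpolating_mmspace_of_dense : exists (Z : mmspace R)
    (psi : {mfun (borel X0 * borel X1)%type >-> borel Z})
    (xi0 : {mfun borel Z >-> borel X0}) (xi1 : {mfun borel Z >-> borel X1}),
  [/\ forall A, mm_meas Z A = gam (psi @^-1` A),
      forall z w : Z, mdist z w = (1 - s) * @mdist R X0 (xi0 z) (xi0 w) +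
                                  s * @mdist R X1 (xi1 z) (xi1 w)
    & exists N, [/\ measurable N, gam N = 0%E &
        forall p, ~ N p -> xi0 (psi p) = p.1 /\ xi1 (psi p) = p.2]].
Proof.
exists Zmm, (mkmfun measurable_toZ), (mkmfun measurable_pt1), (mkmfun measurable_pt2).
split => //; exists Sc; split => // p Sp.
by split => /=; rewrite toZK.
Qed.

End interpolation.

(** The space [Z] is the support of [gam] with the distance that interpolates
    those of [X0] and [X1]; [psi] retracts the product onto it, and [xi0], [xi1]
    are its two coordinates. They invert [psi] only off the null set [N], while
    the formula for the distance holds everywhere. *)
Lemma interpolating_mmspace (R : realType) (X0 X1 : completeMetricType R) (s : R)
    (s01 : 0 < s < 1) (sX0 : separable_space X0) (sX1 : separable_space X1)
    (gam : probability (borel X0 * borel X1)%type R) :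
  exists (Z : mmspace R)
    (psi : {mfun (borel X0 * borel X1)%type >-> borel Z})
    (xi0 : {mfun borel Z >-> borel X0}) (xi1 : {mfun borel Z >-> borel X1}),
  [/\ forall A, mm_meas Z A = gam (psi @^-1` A),
      forall z w : Z, mdist z w = (1 - s) * @mdist R X0 (xi0 z) (xi0 w) +
                                  s * @mdist R X1 (xi1 z) (xi1 w)
    & exists N, [/\ measurable N, gam N = 0%E &
        forall p, ~ N p -> xi0 (psi p) = p.1 /\ xi1 (psi p) = p.2]].
Proof.
have [a0 ha0] := separable_seq sX0; have [a1 ha1] := separable_seq sX1.
exact: interpolating_mmspace_of_dense ha0 ha1.
Qed.

(** * Costs of images and invariance under equivalence *)

Lemma measure_rectangle_unique d1 d2 (T1 : measurableType d1) (T2 : measurableType d2)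
    (R : realType) (P Q : probability (T1 * T2)%type R) :
  (forall A B, measurable A -> measurable B -> P (A `*` B) = Q (A `*` B)) ->
  forall S, measurable S -> P S = Q S.
Proof.
move=> PQ S mS.
apply: (measure_unique [set A `*` B | A in measurable & B in measurable] (fun _ => setT)) => //.
- exact: measurable_prod_measurableType.
- move=> _ _ [A mA [B mB <-]] [A' mA' [B' mB' <-]].
  exists (A `&` A'); first exact: measurableI.
  by exists (B `&` B'); [exact: measurableI|rewrite setXI].
- by move=> _; exists setT => //; exists setT => //; rewrite setXTT.
- by apply/seteqP; split => // x _; exists 0%N.
- by move=> _ [A mA [B mB <-]]; exact: PQ.
- by move=> k; apply: (le_lt_trans (probability_le1 _ measurableT)); rewrite ltry.
Qed.

Section image_cost.
Context (R : realType) (X Y : mmspace R).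

Lemma measurable_image_sqdistortion d (Om : measurableType d)
    (f : {mfun Om >-> borel X}) (g : {mfun Om >-> borel Y}) :
  measurable_fun setT (fun w : Om * Om =>
    (`| @mdist R X (f w.1) (f w.2) - @mdist R Y (g w.1) (g w.2) | ^+ 2)%:E).
Proof.
have mfg : measurable_fun setT (fun x => (f x, g x)).
  exact: measurable_fun_pair.
have mff : measurable_fun setT (fun w : Om * Om => ((f w.1, g w.1), (f w.2, g w.2))).
  by apply: measurable_fun_pair; apply: (measurableT_comp mfg);
    [exact: measurable_fst|exact: measurable_snd].
exact: measurableT_comp (@measurable_sqdistortion R X Y) mff.
Qed.

(** The cost of a coupling read on any space carrying a pair of maps with this
    joint law; all costs to be compared can then be integrated over one space. *)
Lemma GW_cost_image d (Om : measurableType d) (P : probability Om R)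
    (pi : probability (borel X * borel Y)%type R)
    (f : {mfun Om >-> borel X}) (g : {mfun Om >-> borel Y}) :
  (forall A B, measurable A -> measurable B ->
    pi (A `*` B) = P (f @^-1` A `&` g @^-1` B)) ->
  GW_cost pi = (\int[P \x P]_w
    (`| @mdist R X (f w.1) (f w.2) - @mdist R Y (g w.1) (g w.2) | ^+ 2)%:E)%E.
Proof.
move=> piE.
have mfg : measurable_fun setT (fun x => (f x, g x)).
  exact: measurable_fun_pair.
pose Q := distribution P (mkmfun mfg).
have piQ S : measurable S -> pi S = Q S.
  by move: S; apply: measure_rectangle_unique => A B mA mB; exact: piE.
pose D (w : (borel X * borel Y) * (borel X * borel Y)) : \bar R :=
  (distortion w ^+ 2)%:E.
have D0 w : (0 <= D w)%E by rewrite lee_fin sqr_ge0.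
have mD : measurable_fun setT D by exact: measurable_sqdistortion.
have mDp p : measurable_fun setT (fun q => D (p, q)).
  exact: measurableT_comp mD (measurable_pair1 _).
rewrite integral_productE; last 2 first.
- exact: measurable_image_sqdistortion.
- by move=> w; rewrite lee_fin sqr_ge0.
rewrite /GW_cost (eq_measure_integral Q); last by move=> S mS _; exact: piQ.
rewrite ge0_integral_distribution; last 2 first.
- under eq_fun => p.
    rewrite (eq_measure_integral Q); last by move=> S mS _; exact: piQ.
    over.
  exact: (measurable_fun_fubini_tonelli_F D).
- by move=> p; apply: integral_ge0 => q _; rewrite lee_fin sqr_ge0.
apply: eq_integral => x _ /=.
rewrite (eq_measure_integral Q); last by move=> S mS _; exact: piQ.
rewrite ge0_integral_distribution//.
exact: mDp (f x, g x).
Qed.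
End image_cost.

Section equivalence_invariance.
Context (R : realType).

Lemma mm_equiv_refl (X : mmspace R) : mm_equiv X X.
Proof.
by exists (mkmfun (@measurable_id _ (borel X) setT)).
Qed.

(** Full support makes the map of an equivalence isometric everywhere, so that it
    transports couplings without changing their cost. *)
Lemma GW2_mm_equiv_le (X Z Y : mmspace R) : mm_equiv X Z ->
  (GW2_mm Z Y <= GW2_mm X Y)%E.
Proof.
move=> [T [isoT imT]]; apply: le_ereal_inf_tmp => _ [pi /couplingsP[piX piY] <-].
have mfst := @measurable_fst _ _ (borel X) (borel Y).
have mf : measurable_fun setT (fun p : borel X * borel Y => T p.1).
  exact: measurableT_comp.
pose g := mkmfun (@measurable_snd _ _ (borel X) (borel Y)).
have mfg : measurable_fun setT (fun p : borel X * borel Y => (T p.1, p.2)).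
  by apply: measurable_fun_pair => //; exact: measurable_snd.
pose rho := distribution pi (mkmfun mfg).
have mT A : measurable A -> measurable (T @^-1` A).
  by move=> mA; rewrite -[X in measurable X]setTI; exact: measurable_funPT.
have crho : couplings Z Y rho.
  apply/couplingsP; split => [A mA|B mB].
    rewrite -imT// /pushforward -piX; last exact: mT.
    by congr (pi _); apply/seteqP; split => -[x y] [].
  by rewrite -piY//; congr (pi _); apply/seteqP; split => -[x y] [].
apply: le_trans (GW2_mm_le crho) _.
rewrite (GW_cost_image (P := pi) (f := mkmfun mf) (g := g)); last first.
  by move=> A B mA mB; congr (pi _); apply/seteqP; split => -[x y] [].
rewrite -[leRHS]/(GW_cost pi) GW_costE le_eqVlt; apply/orP; left; apply/eqP.
apply: eq_integral => -[[x y] [x' y']] _ /=.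
by rewrite isoT// mm_full_support.
Qed.

Lemma mm_reprP (C : GW_classes R) : sval C = mm_class (mm_repr C).
Proof. by rewrite /mm_repr; case: (cid (proj2_sig C)). Qed.

Definition GW_class_of (X : mmspace R) : GW_classes R :=
  exist _ (mm_class X) (ex_intro _ X erefl).

(** The space [Z] and the representative of its class are equivalent in both
    directions, each belonging to the class of the other. *)
Lemma GW2_mm_repr (Z Y : mmspace R) :
  GW2_mm (mm_repr (GW_class_of Z)) Y = GW2_mm Z Y.
Proof.
have /= E := mm_reprP (GW_class_of Z).
apply/eqP; rewrite eq_le !GW2_mm_equiv_le//.
  rewrite -[mm_equiv _ _]/(mm_class _ Z) -E; exact: mm_equiv_refl.
rewrite -[mm_equiv _ _]/(mm_class Z _) E; exact: mm_equiv_refl.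
Qed.

End equivalence_invariance.

(** * A coupling with the interpolating space *)

Lemma measure_eq_mod_null d (T : measurableType d) (R : realType)
    (mu : probability T R) (E F N : set T) :
  measurable E -> measurable F -> measurable N -> mu N = 0%E ->
  (forall x, ~ N x -> E x <-> F x) -> mu E = mu F.
Proof.
move=> mE mF mN N0 EF.
have le (A B : set T) : measurable A -> measurable B ->
    (forall x, ~ N x -> A x -> B x) -> (mu A <= mu B)%E.
  move=> mA mB AB; apply: (@le_trans _ _ (mu (B `|` N))).
    apply: measure_mono => //; first exact: measurableU.
    by move=> x Ax; have [Nx|nNx] := pselect (N x); [right|left; exact: AB].
  apply: (@le_trans _ _ (mu B + mu N)%E); first exact: measureU2.
  by rewrite N0 adde0.
by apply/eqP; rewrite eq_le !le// => x /EF[].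
Qed.

Section gluing_interpolation.
Context (R : realType) (X0 X1 Y : mmspace R) (s : R) (s01 : 0 < s < 1).
Variables (pi0 : probability (borel X0 * borel Y)%type R)
          (pi1 : probability (borel X1 * borel Y)%type R).
Hypotheses (cpi0 : couplings X0 Y pi0) (cpi1 : couplings X1 Y pi1).

(** Glue [pi0] and [pi1] along [Y] into the law of a triple [(x0, x1, y)], take
    for [Z] the space interpolating the law of [(x0, x1)], and for [Gam] the law
    of the pair made of the image of [(x0, x1)] in [Z] and of [y]. *)
Lemma interpolating_coupling : exists (Z : mmspace R)
    (xi0 : {mfun borel Z >-> borel X0}) (xi1 : {mfun borel Z >-> borel X1})
    (Gam : probability (borel Z * borel Y)%type R),
  [/\ couplings Z Y Gam,
      forall z w : Z, mdist z w = (1 - s) * @mdist R X0 (xi0 z) (xi0 w) +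
                                  s * @mdist R X1 (xi1 z) (xi1 w),
      forall A B, measurable A -> measurable B ->
        pi0 (A `*` B) = Gam (xi0 @^-1` A `*` B)
    & forall A B, measurable A -> measurable B ->
        pi1 (A `*` B) = Gam (xi1 @^-1` A `*` B)].
Proof.
have [piX0 piY0] := (couplingsP _).1 cpi0; have [piX1 piY1] := (couplingsP _).1 cpi1.
pose psnd := mkmfun (@measurable_snd _ _ (borel X1) (borel Y)).
have psndE D : measurable D -> pi0 (setT `*` D) = pi1 (psnd @^-1` D).
  by move=> mD; rewrite piY0// -piY1// setTX.
have [L [LT Lpi0]] := gluing (@mm_separable _ X0) psndE.
pose T := (borel X0 * (borel X1 * borel Y))%type.
have m1 : measurable_fun setT (fun p : T => p.1) by exact: measurable_fst.
have m21 : measurable_fun setT (fun p : T => p.2.1).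
  by apply: measurableT_comp; [exact: measurable_fst|exact: measurable_snd].
have m22 : measurable_fun setT (fun p : T => p.2.2).
  by apply: measurableT_comp; exact: measurable_snd.
have m01 : measurable_fun setT (fun p : T => (p.1, p.2.1)).
  exact: measurable_fun_pair.
pose gam := distribution L (mkmfun m01).
have [Z [psi [xi0 [xi1 [psiE dE [N [mN N0 xiE]]]]]]] :=
  interpolating_mmspace s01 (@mm_separable _ X0) (@mm_separable _ X1) gam.
have mpsi : measurable_fun setT (fun p : T => psi (p.1, p.2.1)).
  exact: (measurableT_comp (@measurable_funPT _ _ _ _ psi) m01).
have mG : measurable_fun setT (fun p : T => (psi (p.1, p.2.1), p.2.2)).
  exact: measurable_fun_pair.
pose Gam := distribution L (mkmfun mG).
pose N' : set T := (fun p => (p.1, p.2.1)) @^-1` N.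
have mpre d (U : measurableType d) (f : T -> U) (A : set U) :
    measurable_fun setT f -> measurable A -> measurable (f @^-1` A).
  by move=> mf mA; rewrite -[X in measurable X]setTI; exact: mf.
have mN' : measurable N' by exact: mpre.
have N'0 : L N' = 0%E by [].
have mxi0 A : measurable A -> measurable (xi0 @^-1` A).
  exact: measurable_funPTI.
have mxi1 A : measurable A -> measurable (xi1 @^-1` A).
  exact: measurable_funPTI.
exists Z, xi0, xi1, Gam; split => //.
- apply/couplingsP; split => [A mA|B mB].
    rewrite psiE /Gam /gam /distribution /pushforward.
    by congr (L _); apply/seteqP; split => -[x [y z]] //= [].
  rewrite -piY1// -(LT (setT `*` B)); last exact: measurableX.
  rewrite /Gam /distribution /pushforward; congr (L _).
  by apply/seteqP; split => -[x [y z]] //= [? ?].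
- move=> A B mA mB; rewrite -Lpi0//.
  apply: (measure_eq_mod_null _ _ mN' N'0).
  + by apply: measurableX => //; rewrite -[X in measurable X]setTI; exact: measurable_funPT.
  + by apply: mpre => //; apply: measurableX => //; exact: mxi0.
  + move=> [x0 [x1 y]] /xiE[/= e0 e1].
    by split => -[/=]; rewrite /= e0.
- move=> A B mA mB; rewrite -LT; last exact: measurableX.
  apply: (measure_eq_mod_null _ _ mN' N'0).
  + by apply: measurableX => //; exact: measurableX.
  + by apply: mpre => //; apply: measurableX => //; exact: mxi1.
  + move=> [x0 [x1 y]] /xiE[/= e0 e1].
    by split => [[_ [/= Ax By]]|[/= Ax By]]; [rewrite -e1 in Ax|rewrite e1 in Ax].
Qed.

End gluing_interpolation.

(** * The variational inequality *)

Section key_inequality.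
Context (R : realType) (X0 X1 Y Z : mmspace R) (s : R) (s01 : 0 < s < 1).
Variables (xi0 : {mfun borel Z >-> borel X0}) (xi1 : {mfun borel Z >-> borel X1}).
Variables (pi0 : probability (borel X0 * borel Y)%type R)
          (pi1 : probability (borel X1 * borel Y)%type R)
          (Gam : probability (borel Z * borel Y)%type R).
Hypothesis cGam : couplings Z Y Gam.
Hypotheses (cpi0 : couplings X0 Y pi0) (cpi1 : couplings X1 Y pi1).
Hypothesis dZ : forall z w : Z, mdist z w =
  (1 - s) * @mdist R X0 (xi0 z) (xi0 w) + s * @mdist R X1 (xi1 z) (xi1 w).
Hypothesis pi0E : forall A B, measurable A -> measurable B ->
  pi0 (A `*` B) = Gam (xi0 @^-1` A `*` B).
Hypothesis pi1E : forall A B, measurable A -> measurable B ->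
  pi1 (A `*` B) = Gam (xi1 @^-1` A `*` B).

Let s_gt0 : 0 < s. Proof. by case/andP: s01. Qed.
Let s_lt1 : 0 < 1 - s. Proof. by case/andP: s01; rewrite subr_gt0. Qed.

Let mpre d1 d2 (T : measurableType d1) (U : measurableType d2)
    (f : {mfun T >-> U}) (A : set U) : measurable A -> measurable (f @^-1` A).
Proof. exact: measurable_funPTI. Qed.

Lemma integral_mix d (T : measurableType d) (mu : {measure set T -> \bar R})
    (f g0 g1 : T -> R) :
  (forall w, 0 <= f w) -> (forall w, 0 <= g0 w) -> (forall w, 0 <= g1 w) ->
  measurable_fun setT (fun w => (f w)%:E) ->
  measurable_fun setT (fun w => (g0 w)%:E) ->
  measurable_fun setT (fun w => (g1 w)%:E) ->
  (\int[mu]_w (f w + ((1 - s) * g0 w + s * g1 w))%:E =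
   \int[mu]_w (f w)%:E + ((1 - s)%:E * \int[mu]_w (g0 w)%:E +
                          s%:E * \int[mu]_w (g1 w)%:E))%E.
Proof.
move=> f0 g00 g10 mf mg0 mg1; have s0 := ltW s_gt0; have s1 := ltW s_lt1.
have mZ (k : R) (g : T -> R) : measurable_fun setT (fun w => (g w)%:E) ->
    measurable_fun setT (fun w => (k%:E * (g w)%:E)%E).
  by move=> mg; exact: measurable_funeM.
rewrite -[(_ * \int[mu]_w (g0 w)%:E)%E]ge0_integralZl ?lee_fin//; last first.
  by move=> w _; rewrite lee_fin.
rewrite -[(_ * \int[mu]_w (g1 w)%:E)%E]ge0_integralZl ?lee_fin//; last first.
  by move=> w _; rewrite lee_fin.
have m0 := mZ (1 - s) g0 mg0; have m1 := mZ s g1 mg1.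
rewrite -ge0_integralD//; last 2 first.
- by move=> w _; rewrite mule_ge0// lee_fin.
- by move=> w _; rewrite mule_ge0// lee_fin.
rewrite -ge0_integralD//.
- by move=> w _; rewrite lee_fin.
- by move=> w _; rewrite adde_ge0// mule_ge0// lee_fin.
- exact: emeasurable_funD.
Qed.

Lemma measurable_mix d (T : measurableType d) (f g0 g1 : T -> R) :
  measurable_fun setT (fun w => (f w)%:E) ->
  measurable_fun setT (fun w => (g0 w)%:E) ->
  measurable_fun setT (fun w => (g1 w)%:E) ->
  measurable_fun setT (fun w => (f w + ((1 - s) * g0 w + s * g1 w))%:E).
Proof.
move=> /measurable_EFinP mf /measurable_EFinP mg0 /measurable_EFinP mg1.
apply/measurable_EFinP; apply: measurable_funD => //.
by apply: measurable_funD; apply: measurable_funM.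
Qed.

(** The correction [s * (1 - s) * (a0 - a1) ^+ 2] does not depend on [b]; this is
    what makes the squared cost on the line nonnegatively cross-curved. *)
Lemma sqdist_mix (a0 a1 b : R) :
  `|(1 - s) * a0 + s * a1 - b| ^+ 2 + s * (1 - s) * (a0 - a1) ^+ 2 =
  (1 - s) * `|a0 - b| ^+ 2 + s * `|a1 - b| ^+ 2.
Proof. rewrite !real_normK ?num_real//; lra. Qed.

(** Dropping the correction in [sqdist_mix] gives convexity, hence finiteness of
    the cost along the path. *)
Lemma interpolated_cost_le :
  (GW_cost Gam <= (1 - s)%:E * GW_cost pi0 + s%:E * GW_cost pi1)%E.
Proof.
pose pfst := mkmfun (@measurable_fst _ _ (borel Z) (borel Y)).
pose psnd := mkmfun (@measurable_snd _ _ (borel Z) (borel Y)).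
pose f0 := mkmfun (measurableT_comp (@measurable_funPT _ _ _ _ xi0)
  (@measurable_fst _ _ (borel Z) (borel Y))).
pose f1 := mkmfun (measurableT_comp (@measurable_funPT _ _ _ _ xi1)
  (@measurable_fst _ _ (borel Z) (borel Y))).
rewrite (GW_cost_image (P := Gam) (f := f0) (g := psnd)); last by move=> A B mA mB; rewrite pi0E.
rewrite (GW_cost_image (P := Gam) (f := f1) (g := psnd)); last by move=> A B mA mB; rewrite pi1E.
rewrite (GW_cost_image (P := Gam) (f := pfst) (g := psnd)); last by [].
have := @integral_mix _ _ (Gam \x Gam)%E (cst 0)
  (fun w => `|@mdist R X0 (f0 w.1) (f0 w.2) - @mdist R Y (psnd w.1) (psnd w.2)| ^+ 2)
  (fun w => `|@mdist R X1 (f1 w.1) (f1 w.2) - @mdist R Y (psnd w.1) (psnd w.2)| ^+ 2).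
rewrite integral0 add0e => <- //; try (by move=> w; exact: sqr_ge0);
  try exact: measurable_image_sqdistortion; try exact: (@measurable_cst _ _ _ _ setT 0%E).
apply: ge0_le_integral => //.
- exact: measurable_image_sqdistortion.
- by apply: measurable_mix; [exact: (@measurable_cst _ _ _ _ setT 0%E)
                             |exact: measurable_image_sqdistortion..].
- move=> w _; rewrite lee_fin /= add0r -sqdist_mix dZ lerDl.
  by apply: mulr_ge0; [apply: mulr_ge0; exact: ltW|exact: sqr_ge0].
Qed.

(** Glue [sig] to [Gam] along [Z]. On the resulting space of points
    [(y', (z, y))], adding the identities [sqdist_mix] for [b] the distance in
    [Y] and for [b] the distance in [Y'] cancels the corrections: the inequality
    is an equality between integrals once the two infima are replaced by the
    costs of the couplings [tau0] and [tau1] of [X0], [X1] with [Y']. *)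
Lemma interpolation_key_inequality (Y' : mmspace R)
    (sig : probability (borel Z * borel Y')%type R) : couplings Z Y' sig ->
  (GW_cost Gam + ((1 - s)%:E * GW2_mm X0 Y' + s%:E * GW2_mm X1 Y') <=
   GW_cost sig + ((1 - s)%:E * GW_cost pi0 + s%:E * GW_cost pi1))%E.
Proof.
move=> csig.
have [sigZ sigY'] := (couplingsP _).1 csig.
have [GamZ GamY] := (couplingsP _).1 cGam.
pose swap := mkmfun (measurable_fun_pair (@measurable_snd _ _ (borel Z) (borel Y'))
  (@measurable_fst _ _ (borel Z) (borel Y'))).
pose gis := distribution sig swap.
have gisE B A : gis (B `*` A) = sig (A `*` B).
  by congr (sig _); apply/seteqP; split => -[z y] [].
pose pfst := mkmfun (@measurable_fst _ _ (borel Z) (borel Y)).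
have psiE A : measurable A -> gis (setT `*` A) = Gam (pfst @^-1` A).
  by move=> mA; rewrite gisE sigZ// -GamZ// setXT.
have [L [LT Lgis]] := gluing (@mm_separable _ Y') psiE.
pose Om := (borel Y' * (borel Z * borel Y))%type.
pose m1 := @measurable_fst _ _ (borel Y') (borel Z * borel Y)%type.
pose m2 := @measurable_snd _ _ (borel Y') (borel Z * borel Y)%type.
pose y' : {mfun Om >-> borel Y'} := mkmfun m1.
pose z : {mfun Om >-> borel Z} :=
  mkmfun (measurableT_comp (@measurable_fst _ _ (borel Z) (borel Y)) m2).
pose y : {mfun Om >-> borel Y} :=
  mkmfun (measurableT_comp (@measurable_snd _ _ (borel Z) (borel Y)) m2).
pose x0 : {mfun Om >-> borel X0} :=
  mkmfun (measurableT_comp (@measurable_funPT _ _ _ _ xi0) (@measurable_funPT _ _ _ _ z)).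
pose x1 : {mfun Om >-> borel X1} :=
  mkmfun (measurableT_comp (@measurable_funPT _ _ _ _ xi1) (@measurable_funPT _ _ _ _ z)).
have LGam A B : measurable A -> measurable B ->
    Gam (A `*` B) = L (z @^-1` A `&` y @^-1` B).
  move=> mA mB; rewrite -LT; last exact: measurableX.
  by congr (L _); apply/seteqP; split => -[a [b c]]; [move=> [_ []]|move=> []].
have Lsig A B : measurable A -> measurable B ->
    sig (A `*` B) = L (z @^-1` A `&` y' @^-1` B).
  move=> mA mB; apply: (etrans (esym (gisE B A))).
  apply: (etrans (esym (Lgis B A mB mA))).
  by congr (L _); apply/seteqP; split => -[a [b c]] [].
have Lpi0 A B : measurable A -> measurable B ->
    pi0 (A `*` B) = L (x0 @^-1` A `&` y @^-1` B).
  by move=> mA mB; rewrite pi0E// LGam//; exact: mpre.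
have Lpi1 A B : measurable A -> measurable B ->
    pi1 (A `*` B) = L (x1 @^-1` A `&` y @^-1` B).
  by move=> mA mB; rewrite pi1E// LGam//; exact: mpre.
pose tau0 := distribution L (mkmfun (measurable_fun_pair
  (@measurable_funPT _ _ _ _ x0) (@measurable_funPT _ _ _ _ y'))).
pose tau1 := distribution L (mkmfun (measurable_fun_pair
  (@measurable_funPT _ _ _ _ x1) (@measurable_funPT _ _ _ _ y'))).
have tau0E A B : tau0 (A `*` B) = L (x0 @^-1` A `&` y' @^-1` B) by [].
have tau1E A B : tau1 (A `*` B) = L (x1 @^-1` A `&` y' @^-1` B) by [].
have Ly' B : measurable B -> L (y' @^-1` B) = mm_meas Y' B.
  move=> mB; rewrite -sigY'// Lsig//.
  by congr (L _); apply/seteqP; split => // w [].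
have [pi0X pi0Y] := (couplingsP _).1 cpi0; have [pi1X pi1Y] := (couplingsP _).1 cpi1.
have ctau0 : couplings X0 Y' tau0.
  apply/couplingsP; split => [A mA|B mB].
    by apply: (etrans (tau0E _ _)); rewrite preimage_setT setIT -pi0X// Lpi0// preimage_setT setIT.
  by apply: (etrans (tau0E _ _)); rewrite preimage_setT setTI Ly'.
have ctau1 : couplings X1 Y' tau1.
  apply/couplingsP; split => [A mA|B mB].
    by apply: (etrans (tau1E _ _)); rewrite preimage_setT setIT -pi1X// Lpi1// preimage_setT setIT.
  by apply: (etrans (tau1E _ _)); rewrite preimage_setT setTI Ly'.
apply: (@le_trans _ _ (GW_cost Gam +
    ((1 - s)%:E * GW_cost tau0 + s%:E * GW_cost tau1))%E).
  apply: leeD2l; apply: leeD.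
    by apply: lee_wpmul2l; [rewrite lee_fin ltW|exact: GW2_mm_le].
  by apply: lee_wpmul2l; [rewrite lee_fin ltW|exact: GW2_mm_le].
rewrite (GW_cost_image (P := L) (f := z) (g := y))//.
rewrite (GW_cost_image (P := L) (f := z) (g := y'))//.
rewrite (GW_cost_image (P := L) (f := x0) (g := y))//.
rewrite (GW_cost_image (P := L) (f := x1) (g := y))//.
rewrite (GW_cost_image (P := L) (f := x0) (g := y'))//.
rewrite (GW_cost_image (P := L) (f := x1) (g := y'))//.
rewrite -!integral_mix//;
  try (by move=> w; exact: sqr_ge0); try exact: measurable_image_sqdistortion.
rewrite le_eqVlt; apply/orP; left; apply/eqP; apply: eq_integral => w _.
congr (_%:E); rewrite -!sqdist_mix dZ /=.
set A := (_ ^+ 2); set B := (_ ^+ 2); lra.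
Qed.

End key_inequality.

(** Optimality of [pi0] and [pi1] is essential: their costs stand on the larger
    side, where nearly optimal couplings would leave an error. *)
Lemma GW2_mm_interpolation (R : realType) (X0 X1 Y : mmspace R) (s : R) :
  0 < s < 1 -> GW2_mm X0 Y \is a fin_num -> GW2_mm X1 Y \is a fin_num ->
  exists Z : mmspace R,
    [/\ GW2_mm Z Y \is a fin_num &
    forall Y' : mmspace R,
    (GW2_mm Z Y + ((1 - s)%:E * GW2_mm X0 Y' + s%:E * GW2_mm X1 Y') <=
     GW2_mm Z Y' + ((1 - s)%:E * GW2_mm X0 Y + s%:E * GW2_mm X1 Y))%E].
Proof.
move=> s01 fin0 fin1.
have [pi0 [cpi0 pi0opt]] := optimal_coupling fin0.
have [pi1 [cpi1 pi1opt]] := optimal_coupling fin1.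
have [Z [xi0 [xi1 [Gam [cGam dZ pi0E pi1E]]]]] := interpolating_coupling s01 cpi0 cpi1.
set c := ((1 - s)%:E * GW2_mm X0 Y + s%:E * GW2_mm X1 Y)%E.
have cfin : c \is a fin_num by rewrite fin_numD !fin_numM.
exists Z; split.
  rewrite ge0_fin_numE ?GW2_mm_ge0//.
  apply: (@le_lt_trans _ _ c); last by rewrite ltey_eq cfin.
  rewrite /c -pi0opt -pi1opt.
  exact: le_trans (GW2_mm_le cGam) (interpolated_cost_le s01 dZ pi0E pi1E).
move=> Y'; rewrite -leeBlDr//; apply: le_ereal_inf_tmp => _ [sig csig <-].
rewrite leeBlDr// /c -pi0opt -pi1opt.
apply: le_trans (interpolation_key_inequality s01 cGam cpi0 cpi1 dZ pi0E pi1E csig).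
by apply: leeD2r; exact: GW2_mm_le.
Qed.

(** When one of [gy], [q0], [q1] is infinite the hypothesis forces [gy = +oo], and
    the left-hand side of the conclusion is [-oo]. *)
Lemma le_dual_combination (R : realType) (s : R) (gz gy p0 p1 q0 q1 : \bar R) :
  0 < s < 1 -> (0 <= gy)%E -> (0 <= q0)%E -> (0 <= q1)%E ->
  gz \is a fin_num -> p0 \is a fin_num -> p1 \is a fin_num ->
  (gz + ((1 - s)%:E * q0 + s%:E * q1) <=
   gy + ((1 - s)%:E * p0 + s%:E * p1))%E ->
  (gz - gy <= (1 - s)%R%:E * (p0 - q0) + s%:E * (p1 - q1))%dE.
Proof.
move=> /andP[s0 s1]; have t0 : 0 < 1 - s by rewrite subr_gt0.
case: gz p0 p1 => [gz| |] [p0| |] [p1| |] // gy0 q00 q10 _ _ _.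
case: gy gy0 => [gy| |] // _; last by rewrite /= leNye.
case: q0 q00 => [q0| |] // _; case: q1 q10 => [q1| |] // _;
  rewrite ?gt0_muley ?lte_fin// !lee_fin.
rewrite !mulrDr !mulrN; lra.
Qed.

Theorem theorem4p24 (R : realType) : NNCC_space (@GW2 R).
Proof.
move=> C0 C1 D fin0 fin1.
have /choice[Z HZ] : forall s : R, exists Z : mmspace R, 0 < s < 1 ->
    [/\ GW2_mm Z (mm_repr D) \is a fin_num &
    forall Y' : mmspace R,
    (GW2_mm Z (mm_repr D) +
       ((1 - s)%:E * GW2_mm (mm_repr C0) Y' + s%:E * GW2_mm (mm_repr C1) Y') <=
     GW2_mm Z Y' + ((1 - s)%:E * GW2_mm (mm_repr C0) (mm_repr D) +
       s%:E * GW2_mm (mm_repr C1) (mm_repr D)))%E].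
  move=> s; have [s01|] := boolP (0 < s < 1); last by exists (mm_repr D).
  by have [Z HZ] := GW2_mm_interpolation s01 fin0 fin1; exists Z.
pose x s := if s == 0 then C0 else if s == 1 then C1 else GW_class_of (Z s).
have x0 : x 0 = C0 by rewrite /x eqxx.
have x1 : x 1 = C1 by rewrite /x oner_eq0 eqxx.
have xs s : 0 < s < 1 -> x s = GW_class_of (Z s).
  by move=> /andP[s0 s1]; rewrite /x gt_eqF// lt_eqF.
exists x; split => //; split => [s|s D' s01].
  move=> /andP[]; rewrite le_eqVlt => /predU1P[<- _|s0]; first by rewrite x0.
  rewrite le_eqVlt => /predU1P[->|s1]; first by rewrite x1.
  have s01 : 0 < s < 1 by rewrite s0.
  by rewrite xs// /GW2 GW2_mm_repr; case: (HZ s s01).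
rewrite x0 x1 xs//; have [finZ /(_ (mm_repr D')) key] := HZ s s01.
by rewrite /GW2 !GW2_mm_repr; apply: le_dual_combination => //; exact: GW2_mm_ge0.
Qed.
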